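(* Let $\kappa:\mathbb{M}\times\mathbb{M}\to\mathbb{R}$ be a universal and bounded kernel. Let $\hat p_\tau(\mathbf{x},\mathbf{y})=\mathbf{f}(\mathbf{x})^\top\mathbf{q}(\mathbf{y})$ be an approximate transition density with $\mathbf{f}=(f_1,\ldots,f_m)^\top$ and $\mathbf{q}=(q_1,\ldots,q_m)^\top$, and let $\hat{\mathcal{P}}_\tau$ be the corresponding operator. Then: 1. $\mathcal{P}_\tau$ is a Hilbert-Schmidt operator from $\mathcal{L}^2_{\rho_0^{-1}}$ to $\mathcal{L}^2_{\mathcal{E}}$, and the corresponding Hilbert-Schmidt norm of the modeling error satisfies $$\|\hat{\mathcal{P}}_\tau-\mathcal{P}_\tau\|_{\mathrm{HS}}^2=\int\rho_0(\mathbf{x})\,\|\hat p_\tau(\mathbf{x},\cdot)-p_\tau(\mathbf{x},\cdot)\|_{\mathcal{E}}^2\,\mathrm{d}\mathbf{x}.$$ 2. The Hilbert-Schmidt norm of $\hat{\mathcal{P}}_\tau-\mathcal{P}_\tau$ satisfies $$\|\hat{\mathcal{P}}_\tau-\mathcal{P}_\tau\|_{\mathrm{HS}}^2=-\mathcal{R}_{\mathcal{E}}[\mathbf{f},\mathbf{q}]+\|\mathcal{P}_\tau\|_{\mathrm{HS}}^2,\qquad \mathcal{R}_{\mathcal{E}}[\mathbf{f},\mathbf{q}]=\mathrm{tr}\left(2\mathbf{C}_{fq}-\mathbf{C}_{ff}\mathbf{C}_{qq}\right),$$ where $\mathbf{C}_{ff}=\mathbb{E}_n[\mathbf{f}(\mathbf{x}_n)\mathbf{f}(\mathbf{x}_n)^\top]$,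 $\mathbf{C}_{qq}=[\langle q_i,q_j\rangle_{\mathcal{E}}]$ and $\mathbf{C}_{fq}=[\langle\mathcal{P}_\tau(f_i\rho_0),q_j\rangle_{\mathcal{E}}]$ are $m\times m$ matrices.
   Context: Let $\mathbb{M}\subset\mathbb{R}^D$ be the state space and $p_\tau(\mathbf{x},\mathbf{y})$ the transition density of a Markovian dynamical system with lag time $\tau$: $p_\tau(\mathbf{x},\cdot)$ is the conditional distribution of $\mathbf{x}_{t+\tau}$ given $\mathbf{x}_t=\mathbf{x}$. It is allowed to be a generalized density, i.e. $p_\tau(\mathbf{x},\mathbf{y})\mathrm{d}\mathbf{y}$ may be any Markov kernel, including a Dirac mass $\delta_{\Theta_\tau(\mathbf{x})}$ for a deterministic system $\mathbf{x}_{t+\tau}=\Theta_\tau(\mathbf{x}_t)$. The Perron-Frobenius operator is $(\mathcal{P}_\tau q)(\mathbf{y})=\int q(\mathbf{x})p_\tau(\mathbf{x},\mathbf{y})\,\mathrm{d}\mathbf{x}$, and $(\hat{\mathcal{P}}_\tau q)(\mathbf{y})=\int q(\mathbf{x})\hat p_\tau(\mathbf{x},\mathbf{y})\,\mathrm{d}\mathbf{x}$. Transition pairs $(\mathbf{x}_n,\mathbf{y}_n)$ have joint distribution $\rho_0(\mathbf{x})p_\tau(\mathbf{x},\mathbf{y})$, with $\rho_0$ a probability density on $\mathbb{M}$, and $\mathbb{E}_n$ denotes expectation with respect to this distribution (the infinite-data mean over transition pairs). $\mathcal{L}^2_{\rho_0^{-1}}$ is the Hilbert space of real functions $q$ on $\mathbb{M}$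 (vanishing a.e. where $\rho_0=0$) with $\langle q,q\rangle_{\rho_0^{-1}}<\infty$, where $\langle q,q'\rangle_{\rho_0^{-1}}=\int q(\mathbf{x})q'(\mathbf{x})\rho_0(\mathbf{x})^{-1}\mathrm{d}\mathbf{x}$. A kernel $\kappa$ is a (measurable) symmetric positive definite function on $\mathbb{M}\times\mathbb{M}$, with reproducing kernel Hilbert space $\mathbb{H}$ and kernel mapping $\varphi:\mathbb{M}\to\mathbb{H}$, $\langle\varphi(\mathbf{x}),\varphi(\mathbf{y})\rangle_{\mathbb{H}}=\kappa(\mathbf{x},\mathbf{y})$. A (generalized) function $q$ on $\mathbb{M}$ is embedded in $\mathbb{H}$ as $\mathcal{E}q=\int\varphi(\mathbf{x})q(\mathbf{x})\,\mathrm{d}\mathbf{x}$. Set $\langle q,q'\rangle_{\mathcal{E}}=\langle\mathcal{E}q,\mathcal{E}q'\rangle_{\mathbb{H}}=\iint\kappa(\mathbf{x},\mathbf{y})q(\mathbf{x})q'(\mathbf{y})\,\mathrm{d}\mathbf{x}\,\mathrm{d}\mathbf{y}$ and $\|q\|^2_{\mathcal{E}}=\langle q,q\rangle_{\mathcal{E}}$. Universality of $\kappa$ ensures that $\mathcal{E}$ is injective (on integrable functions, and on finite signed Borel measures when generalized densities are used), so $\|\cdot\|_{\mathcal{E}}$ is a norm; $\mathcal{L}^2_{\mathcal{E}}=\{q:\|q\|^2_{\mathcal{E}}<\infty\}$ with inner product $\langle\cdot,\cdot\rangle_{\mathcal{E}}$ (completed if necessary). An operator $\mathcal{A}:\mathcal{L}^2_{\rho_0^{-1}}\to\mathcal{L}^2_{\mathcal{E}}$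 is Hilbert-Schmidt if $\|\mathcal{A}\|_{\mathrm{HS}}^2=\sum_k\|\mathcal{A}e_k\|_{\mathcal{E}}^2<\infty$ for an orthonormal basis $(e_k)$ of $\mathcal{L}^2_{\rho_0^{-1}}$. The feature functions $f_i:\mathbb{M}\to\mathbb{R}$ satisfy $\mathbb{E}_n[f_i(\mathbf{x}_n)^2]<\infty$ and the density basis functions $q_i$ are integrable functions (or finite signed measures, written as generalized densities) on $\mathbb{M}$, so that $\|q_i\|_{\mathcal{E}}<\infty$. *)

(* Defs.v *)
From HB Require Import structures.
From mathcomp Require Import all_boot all_order all_algebra.
From mathcomp Require Import all_classical all_reals all_analysis.

Set Implicit Arguments.
Unset Strict Implicit.
Unset Printing Implicit Defensive.

Import Order.TTheory GRing.Theory Num.Theory.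
Import numFieldNormedType.Exports.

Local Open Scope classical_set_scope.
Local Open Scope ring_scope.

(* R^D is [D.-tuple R] with the product sigma-algebra, which is the Borel one.
   Lebesgue measure on it is built by recursion on the dimension, as the image
   of (Lebesgue on R) x (Lebesgue on R^n) under (x, t) |-> x :: t. *)
Section lebesgue_tuple.
Context {R : realType}.
Local Notation leb1 := (@lebesgue_measure R).

Definition tuple_cons n (z : measurableTypeR R * n.-tuple R) : n.+1.-tuple R :=
  [tuple of z.1 :: z.2].

Lemma measurable_tuple_cons n : measurable_fun setT (@tuple_cons n).
Proof.
apply: measurable_cons; last exact: measurable_snd.
exact: (@measurable_fst _ _ (measurableTypeR R) (n.-tuple R)).
Qed.

Section step.
Context n (mu : {sigma_finite_measure set (n.-tuple R) -> \bar R}).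

Definition lebesgue_step : set (n.+1.-tuple R) -> \bar R :=
  pushforward (leb1 \x mu)%E (@tuple_cons n).

Let mcons A : measurable A -> measurable (@tuple_cons n @^-1` A).
Proof.
by move=> mA; rewrite -[X in measurable X]setTI; exact: measurable_tuple_cons.
Qed.

Let step0 : lebesgue_step set0 = 0%E.
Proof. by rewrite /lebesgue_step /pushforward preimage_set0 measure0. Qed.

Let step_ge0 A : (0 <= lebesgue_step A)%E.
Proof. by rewrite /lebesgue_step /pushforward measure_ge0. Qed.

Let step_sigma_additive : semi_sigma_additive lebesgue_step.
Proof.
move=> F mF tF mUF; rewrite /lebesgue_step /pushforward preimage_bigcup.
apply: measure_semi_sigma_additive; first by move=> k; exact: mcons.
- apply/trivIsetP => /= i j _ _ ij; rewrite -preimage_setI.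
  by move/trivIsetP : tF => /(_ _ _ _ _ ij) ->//; rewrite preimage_set0.
- by rewrite -preimage_bigcup; exact: mcons.
Qed.

HB.instance Definition _ := isMeasure.Build _ _ _ lebesgue_step
  step0 step_ge0 step_sigma_additive.

Let step_sigma_finite : sigma_finite setT lebesgue_step.
Proof.
have /sigma_finiteP[F [TF ndF Foo]] := sigma_finiteT leb1.
have /sigma_finiteP[G [TG ndG Goo]] := sigma_finiteT mu.
have TFG : \bigcup_k (F k `*` G k) = setT.
  apply/seteqP; split=> // -[x t] _.
  have : (\bigcup_k F k) x by rewrite -TF.
  have : (\bigcup_k G k) t by rewrite -TG.
  move=> [j _ Gt] [i _ Fx]; exists (maxn i j) => //; split => /=.
    by move: Fx; exact/subsetPset/ndF/leq_maxl.
  by move: Gt; exact/subsetPset/ndG/leq_maxr.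
pose split_tuple (t : n.+1.-tuple R) : measurableTypeR R * n.-tuple R :=
  (thead t, [tuple of behead t]).
have consK : cancel (@tuple_cons n) split_tuple.
  by move=> [x t]; congr pair => //; exact/val_inj.
exists (fun k => split_tuple @^-1` (F k `*` G k)).
  by rewrite -preimage_bigcup TFG preimage_setT.
move=> k; have [mF Fkoo] := Foo k; have [mG Gkoo] := Goo k; split; last first.
  rewrite /lebesgue_step /pushforward -comp_preimage.
  rewrite (_ : split_tuple \o _ = id); last by apply/funext => z; exact: consK.
  by rewrite preimage_id product_measure1E// lte_mul_pinfty// ge0_fin_numE.
rewrite -[X in measurable X]setTI.
suff : measurable_fun setT split_tuple by apply => //; exact: measurableX.
apply/measurable_fun_pairP; split; first exact: (@measurable_tnth _ R n.+1 ord0).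
exact: measurable_behead.
Qed.

HB.instance Definition _ := Measure_isSigmaFinite.Build _ _ _ lebesgue_step
  step_sigma_finite.

End step.

Fixpoint lebesgue_tuple D : {sigma_finite_measure set (D.-tuple R) -> \bar R} :=
  match D with
  | 0 => dirac [tuple]
  | n.+1 => lebesgue_step (lebesgue_tuple n)
  end.

End lebesgue_tuple.
Arguments lebesgue_tuple : clear implicits.

Lemma lebesgue_tuple_box (R : realType) D (A : 'I_D -> set (measurableTypeR R)) :
  (forall i, measurable (A i)) ->
  lebesgue_tuple R D [set t : D.-tuple R | forall i, A i (tnth t i)] =
  (\prod_(i < D) (@lebesgue_measure R) (A i))%E.
Proof.
elim: D A => [|n IH] A mA.
  rewrite big_ord0 /= (_ : [set _ | _] = setT) ?diracT//.
  by apply/seteqP; split => // t _ [].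
rewrite big_ord_recl -IH//= /lebesgue_step /pushforward.
rewrite -product_measure1E//.
  congr ((_ \x _)%E _); apply/seteqP; split => -[x t] /=.
    move=> At; split; first exact: (At ord0).
    by move=> i; have := At (lift ord0 i); rewrite tnthS.
  by move=> [Ax At] i; case: (unliftP ord0 i) => [j|] ->; rewrite ?tnthS//.
rewrite (_ : [set _ | _] =
  \bigcap_(i in [set: 'I_n]) ((@tnth n R) ^~ i) @^-1` A (lift ord0 i)).
  apply: fin_bigcap_measurable => // i _.
  by rewrite -[X in measurable X]setTI; apply: measurable_tnth => //; exact: mA.
by apply/seteqP; split => t h i; [move=> _; exact: h|exact: h].
Qed.

Section charge_integral.
Context d (T : measurableType d) (R : realType).
Local Open Scope ereal_scope.

Definition hahn_pos (nu : {charge set T -> \bar R}) : set T :=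
  projT1 (cid (Hahn_decomposition nu)).

Definition hahn_neg (nu : {charge set T -> \bar R}) : set T :=
  projT1 (cid (projT2 (cid (Hahn_decomposition nu)))).

Lemma hahnP (nu : {charge set T -> \bar R}) :
  hahn_decomposition nu (hahn_pos nu) (hahn_neg nu).
Proof. exact: projT2 (cid (projT2 (cid (Hahn_decomposition nu)))). Qed.

(* [\int_A g dnu] through the Jordan decomposition of nu. *)
Definition charge_integral (nu : {charge set T -> \bar R}) (A : set T)
    (g : T -> \bar R) : \bar R :=
  \int[jordan_pos (hahnP nu)]_(x in A) g x
  - \int[jordan_neg (hahnP nu)]_(x in A) g x.

Local Notation signed := (charge T R).

(* The library's operations on charges, with results of the bundled type. *)
Definition cplus (nu1 nu2 : signed) : signed := cadd nu1 nu2.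
Definition csub (nu1 nu2 : signed) : signed := cadd nu1 (copp nu2).
Definition ctimes (a : R) (nu : signed) : signed := cscale a nu.

Definition clincomb m (c : 'I_m -> R) (nu : 'I_m -> signed) : signed :=
  \big[cplus / (czero : signed)]_(i < m) ctimes (c i) (nu i).

Lemma clincombE m (c : 'I_m -> R) (nu : 'I_m -> signed) A :
  clincomb c nu A = \sum_(i < m) (c i)%:E * nu i A.
Proof.
by apply: (big_ind2 (fun (mu : signed) y => mu A = y)) => // ? ? ? ? <- <-.
Qed.

End charge_integral.

Section kernel_embedding.
Context {R : realType} {D : nat}.
Local Notation state := (D.-tuple R).
Local Notation signed := (charge state R).
Local Notation leb := (lebesgue_tuple R D).
Implicit Types (M : set state) (u v : state -> R).
Implicit Types (kappa : state -> state -> R) (nu : signed).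

(* Functions on [M] are represented by functions on the whole of R^D of which
   only the restriction to [M] matters. *)

Definition prob_density M (rho0 : state -> R) : Prop :=
  [/\ measurable_fun M rho0, (forall x, M x -> 0 <= rho0 x)
    & (\int[leb]_(x in M) (rho0 x)%:E = 1)%E].

Definition psd_kernel M kappa : Prop :=
  [/\ measurable_fun (M `*` M) (fun z : state * state => kappa z.1 z.2),
      (forall x y, M x -> M y -> kappa x y = kappa y x)
    & (forall n (x : 'I_n -> state) (c : 'I_n -> R), (forall i, M (x i)) ->
         0 <= \sum_(i < n) \sum_(j < n) c i * c j * kappa (x i) (x j))].

Definition bounded_kernel M kappa : Prop :=
  exists B : R, forall x y, M x -> M y -> `|kappa x y| <= B.

Definition continuous_kernel M kappa : Prop :=
  forall x y, M x -> M y -> forall e : R, 0 < e ->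
  exists2 r : R, 0 < r & forall x' y', M x' -> M y' ->
    (forall i, `|tnth x i - tnth x' i| < r) ->
    (forall i, `|tnth y i - tnth y' i| < r) ->
    `|kappa x y - kappa x' y'| < e.

(* A continuous kernel is universal if its RKHS is dense in L^2(mu) for every
   finite Borel measure mu on [M] (Carmeli, De Vito, Toigo, Umanita, Anal.
   Appl. 8, 2010).  For bounded kappa the finite combinations of the sections
   kappa(x, .), which are dense in the RKHS, may be used instead of the RKHS.
   No local compactness of [M] and no decay of kappa is required; when [M] is
   locally compact, density of the RKHS in C_0(M) implies this property, and
   this property implies that [embedding] is injective on the finite signed
   Borel measures on [M]. *)
Definition universal_kernel M kappa : Prop :=
  continuous_kernel M kappa /\
  forall (mu : {finite_measure set state -> \bar R}) (g : state -> R),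
    measurable_fun M g -> (\int[mu]_(y in M) (g y ^+ 2)%:E < +oo)%E ->
    forall e : R, 0 < e ->
    exists n (x : 'I_n -> state) (c : 'I_n -> R), (forall i, M (x i)) /\
      (\int[mu]_(y in M) ((g y - \sum_(i < n) c i * kappa (x i) y) ^+ 2)%:E
         < e%:E)%E.

(* Generalized functions on [M] are finite signed measures.  The RKHS is the
   space of functions on [M] with phi x = kappa x, so that the embedding of nu
   is the function y |-> \int kappa(x, y) nu(dx); by the reproducing property
   its inner product with the embedding of nu' is its integral against nu'. *)
Definition embedding M kappa nu (y : state) : \bar R :=
  charge_integral nu M (fun x => (kappa x y)%:E).

Definition innerE M kappa nu nu' : \bar R :=
  charge_integral nu' M (embedding M kappa nu).

Definition norm2E M kappa nu : \bar R := innerE M kappa nu nu.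

Definition L2E M kappa nu : Prop := norm2E M kappa nu \is a fin_num.

Definition L2rho M (rho0 : state -> R) u : Prop :=
  [/\ measurable_fun M u,
      {ae leb, forall x, M x -> rho0 x = 0 -> u x = 0}
    & (\int[leb]_(x in M) (u x ^+ 2 / rho0 x)%:E < +oo)%E].

Definition inner_rho M (rho0 : state -> R) u v : R :=
  \int[leb]_(x in M) (u x * v x / rho0 x).

Definition orthonormal_basis M (rho0 : state -> R) (K : set nat) (e : nat -> state -> R) : Prop :=
  [/\ (forall k, K k -> L2rho M rho0 (e k)),
      (forall j k, K j -> K k -> inner_rho M rho0 (e j) (e k) = (j == k)%:R)
    & (forall u, L2rho M rho0 u -> forall eps : R, 0 < eps ->
         exists (s : seq nat) (c : nat -> R), (forall k, k \in s -> K k) /\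
         let w := fun x => u x - \sum_(k <- s) c k * e k x in
         inner_rho M rho0 w w < eps)].

Section operators.
Variables (M : set state) (rho0 : state -> R) (kappa : state -> state -> R).
Implicit Types A : (state -> R) -> signed.

Definition bounded_operator A : Prop :=
  [/\ (forall u, L2rho M rho0 u -> L2E M kappa (A u)),
      (forall (a : R) u v, L2rho M rho0 u -> L2rho M rho0 v ->
         forall B, measurable B ->
         A (fun x => a * u x + v x) B = (a%:E * A u B + A v B)%E)
    & (exists C : R, forall u, L2rho M rho0 u ->
         (norm2E M kappa (A u) <= (C * inner_rho M rho0 u u)%:E)%E)].

Definition hs_norm2 (K : set nat) (e : nat -> state -> R) A : \bar R :=
  (\esum_(k in K) norm2E M kappa (A (e k)))%E.

Definition hilbert_schmidt A : Prop :=
  bounded_operator A /\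
  exists K e, orthonormal_basis M rho0 K e /\ (hs_norm2 K e A < +oo)%E.

End operators.

(* For a generalized transition density g, the operator
   u |-> \int u(x) g(x, .) dx, i.e. the finite signed measure
   B |-> \int_M u(x) g(x, B) dx; [transfer] takes the value [czero] when there
   is no such finite signed measure. *)
Definition transfer_spec M (g : state -> signed) u nu : Prop :=
  forall B, measurable B ->
    leb.-integrable M (fun x => ((u x)%:E * g x B)%E) /\
    nu B = (\int[leb]_(x in M) ((u x)%:E * g x B))%E.

Definition transfer M (g : state -> signed) u : signed :=
  if pselect (exists nu, transfer_spec M g u nu) is left h
  then projT1 (cid h) else czero.

Definition operator_of_density M (rho0 : state -> R) (g : state -> signed) : Prop :=
  forall u, L2rho M rho0 u -> transfer_spec M g u (transfer M g u).

Section transition.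
Variables (p : R.-pker state ~> state) (x : state).

Definition transition_measure : set state -> \bar R := p x.

HB.instance Definition _ := isCharge.Build _ _ _ transition_measure
  (measure0 (p x)) (@kernel_finite_transition _ _ _ _ _ p x)
  (@measure_semi_sigma_additive _ _ _ (p x)).

Definition transition : signed := transition_measure.

End transition.

(* Mean over transition pairs, of joint distribution rho0(x) p(x, dy). *)
Definition Epairs M (rho0 : state -> R) (p : R.-pker state ~> state)
    (h : state -> state -> R) : \bar R :=
  (\int[leb]_(x in M) ((rho0 x)%:E * \int[p x]_(y in M) (h x y)%:E))%E.

Section score.
Variables (M : set state) (rho0 : state -> R) (kappa : state -> state -> R).
Variables (p : R.-pker state ~> state) (m : nat).
Variables (f : 'I_m -> state -> R) (q : 'I_m -> signed).

Definition Cff : 'M[R]_m :=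
  \matrix_(i, j) fine (Epairs M rho0 p (fun x _ => f i x * f j x)).

Definition Cqq : 'M[R]_m := \matrix_(i, j) fine (innerE M kappa (q i) (q j)).

Definition Cfq : 'M[R]_m :=
  \matrix_(i, j) fine (innerE M kappa
    (transfer M (transition p) (fun x => f i x * rho0 x)) (q j)).

Definition score : R := \tr (2 *: Cfq - Cff *m Cqq).

End score.
End kernel_embedding.

(* Main.v *)
From HB Require Import structures.
Require Import Defs.
From mathcomp Require Import all_boot all_order all_algebra.
From mathcomp Require Import all_classical all_reals all_analysis.
From mathcomp Require Import measurable_realfun ring lra.

Import Order.TTheory GRing.Theory Num.Theory.
Import numFieldNormedType.Exports HBSimple HBNNSimple.

(** Everything becomes transparent in coordinates.  A bounded continuous
    positive semidefinite kernel on a subset of R^D can be written pointwise as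
    kappa x y = sum_k phi_k x * phi_k y with countably many measurable functions
    phi_k whose squares have a bounded sum ([feature_expansion_exists]): run the
    Cholesky algorithm with pivots along a dense sequence of M.  Continuity
    makes the residual kernel tend to 0 at every point, since it vanishes at the
    pivots already used and the distance it induces never exceeds the one
    induced by kappa.

    A finite signed measure nu then has coordinates a_k(nu) = int phi_k dnu, and
    dominated convergence gives <nu, nu'>_E = sum_k a_k(nu) a_k(nu')
    ([inner_cvg], [norm2E_series]).  For the transfer operator of a transition
    density g, and u in L2(1/rho0),
      a_k(A u) = int u(x) G_k(x) dx = <u, G_k rho0>,  G_k(x) = a_k(g(x, .)),
    so each coordinate of A is a continuous linear form.  Parseval in
    L2(1/rho0), followed by two exchanges of sums of nonnegative terms, yields
      sum_j |A e_j|_E^2 = sum_k sum_j <e_j, G_k rho0>^2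
                        = sum_k int G_k^2 rho0 = int rho0(x) |g(x, .)|_E^2 dx
    for every orthonormal basis ([hs_norm2E]); Cauchy-Schwarz in each coordinate
    bounds A by the same quantity ([norm2E_bound]).  With g = phat - p this is
    the first formula, finite by the expansion below.  With g = p the integrand
    is at most rho0 times the bound of the features, so that the transfer
    operator of p is Hilbert-Schmidt.

    The second formula expands |phat(x, .) - p(x, .)|_E^2 bilinearly in the
    q_i and p(x, .) and integrates against rho0 ([integral_norm_err]).  The
    cross terms are the entries of C_fq because <., q_j>_E is integration
    against the embedding of q_j, a bounded measurable function, and integration
    commutes with the transfer operator ([charge_int_transfer_transition]).

    An orthonormal basis exists because universality, applied to the measure
    rho0(x) dx, makes the kernel sections, hence the span of the phi_k, dense in
    L2(rho0); Gram-Schmidt is applied to the functions phi_k rho0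
    ([orthonormal_basis_exists]). *)

Set Implicit Arguments.
Unset Strict Implicit.
Unset Printing Implicit Defensive.

Local Open Scope classical_set_scope.
Local Open Scope ring_scope.

(** * Semi-inner products on spaces of functions: Parseval and Gram-Schmidt *)

Section semi_inner_product.
Context {R : realType} {T : Type}.
Variables (S : set (T -> R)) (ip : (T -> R) -> (T -> R) -> R).
Implicit Types (u v w : T -> R) (e b : nat -> T -> R).

Record semi_inner : Prop := SemiInner {
  si_lc : forall a u v, S u -> S v -> S (fun x => a * u x + v x) ;
  si_linear : forall a u v w, S u -> S v -> S w ->
    ip (fun x => a * u x + v x) w = a * ip u w + ip v w ;
  si_sym : forall u v, ip u v = ip v u ;
  si_ge0 : forall u, S u -> 0 <= ip u u ;
  si_zero : S (fun=> 0) }.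

Hypothesis siP : semi_inner.

Lemma ip0 w : S w -> ip (fun=> 0) w = 0.
Proof.
move=> Sw; have := si_linear siP (-1) (si_zero siP) (si_zero siP) Sw.
by rewrite [X in ip X w](_ : _ = fun=> 0) => [|]; [lra | apply/funext => x; ring].
Qed.

Lemma si_sum (I : Type) (s : seq I) (c : I -> R) (e : I -> T -> R) :
  (forall k, S (e k)) -> S (fun x => \sum_(k <- s) c k * e k x).
Proof.
move=> Se; elim: s => [|k s IH].
  by under eq_fun do rewrite big_nil; exact: si_zero siP.
by under eq_fun do rewrite big_cons; exact: si_lc siP _ _ _ _ _.
Qed.

Lemma ip_sum (I : Type) (s : seq I) (c : I -> R) (e : I -> T -> R) w :
  (forall k, S (e k)) -> S w ->
  ip (fun x => \sum_(k <- s) c k * e k x) w = \sum_(k <- s) c k * ip (e k) w.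
Proof.
move=> Se Sw; elim: s => [|k s IH].
  by under eq_fun do rewrite big_nil; rewrite big_nil ip0.
under eq_fun do rewrite big_cons; rewrite big_cons si_linear// ?IH//.
exact: si_sum.
Qed.

Lemma si_sub u v : S u -> S v -> S (fun x => u x - v x).
Proof.
move=> Su Sv; rewrite (_ : (fun _ => _) = fun x => -1 * v x + u x).
  exact: si_lc siP _ _ _ _ _.
by apply/funext => x; ring.
Qed.

Lemma ipB u v w : S u -> S v -> S w ->
  ip (fun x => u x - v x) w = ip u w - ip v w.
Proof.
move=> Su Sv Sw; rewrite (_ : (fun _ => _) = fun x => -1 * v x + u x).
  by rewrite si_linear//; ring.
by apply/funext => x; ring.
Qed.

Lemma ip_distE u v : S u -> S v ->
  ip (fun x => u x - v x) (fun x => u x - v x) = ip u u - 2 * ip u v + ip v v.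
Proof.
move=> Su Sv; rewrite ipB ?(si_sym siP u) ?(si_sym siP v) ?ipB//; try exact: si_sub.
by rewrite (si_sym siP v u); ring.
Qed.

Lemma ipD_le u v : S u -> S v ->
  ip (fun x => u x + v x) (fun x => u x + v x) <= 2 * ip u u + 2 * ip v v.
Proof.
move=> Su Sv; have Sv' : S (fun x => - v x).
  rewrite (_ : (fun _ => _) = fun x => 0 - v x); first exact: si_sub (si_zero siP) Sv.
  by apply/funext => x; rewrite sub0r.
have ipN w : S w -> ip (fun x => - v x) w = - ip v w.
  move=> Sw; rewrite (_ : (fun _ => _) = fun x => 0 - v x).
    by rewrite ipB ?ip0 ?sub0r//; exact: si_zero siP.
  by apply/funext => x; rewrite sub0r.
rewrite (_ : (fun x => u x + v x) = fun x => u x - - v x).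
  have uNv : ip u (fun x => - v x) = - ip u v.
    by rewrite (si_sym siP) ipN// (si_sym siP v).
  have vNv : ip v (fun x => - v x) = - ip v v by rewrite (si_sym siP) ipN.
  by have := si_ge0 siP (si_sub Su Sv); rewrite !ip_distE// ipN// vNv uNv; lra.
by apply/funext => x; rewrite opprK.
Qed.

Lemma ip_CS u v : S u -> S v -> ip u v ^+ 2 <= ip u u * ip v v.
Proof.
move=> Su Sv.
have H a : 0 <= a ^+ 2 * ip u u + 2 * a * ip u v + ip v v.
  have Sw : S (fun x => a * u x + v x) by exact: si_lc siP _ _ _ _ _.
  have := si_ge0 siP Sw; rewrite si_linear// (si_sym siP u) (si_sym siP v).
  by rewrite !si_linear// (si_sym siP v u) => h; apply: le_trans h _; lra.
have := si_ge0 siP Su; rewrite le_eqVlt => /predU1P[u0|u0].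
  have [->|uv0] := eqVneq (ip u v) 0; first by rewrite -u0; lra.
  have := H (- (ip v v + 1) / (2 * ip u v)); rewrite -u0 mulr0 add0r.
  rewrite (_ : 2 * _ * _ = - (ip v v + 1)); first by lra.
  by field.
have := H (- ip u v / ip u u).
rewrite (_ : _ + _ + _ = ip v v - ip u v ^+ 2 / ip u u); last first.
  by field; rewrite gt_eqF.
by rewrite subr_ge0 ler_pdivrMr// mulrC.
Qed.

Lemma ip_null u v : S u -> S v -> ip v v = 0 -> ip u v = 0.
Proof.
move=> Su Sv v0; have := ip_CS Su Sv; rewrite v0 mulr0 => h.
by apply/eqP; rewrite -sqrf_eq0 eq_le h sqr_ge0.
Qed.

Definition is_onb (K : set nat) e : Prop :=
  [/\ (forall k, K k -> S (e k)),
      (forall j k, K j -> K k -> ip (e j) (e k) = (j == k)%:R)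
    & (forall u, S u -> forall eps : R, 0 < eps ->
         exists (s : seq nat) (c : nat -> R), (forall k, k \in s -> K k) /\
         let w := fun x => u x - \sum_(k <- s) c k * e k x in
         ip w w < eps)].

Section parseval.
Variables (K : set nat) (e : nat -> T -> R).
Hypotheses (Se : forall k, K k -> S (e k))
  (ortho : forall j k, K j -> K k -> ip (e j) (e k) = (j == k)%:R).

(** Completing the square in every coefficient: Bessel's inequality is the case
    where the last sum vanishes, and the last sum being nonnegative says that no
    choice of coefficients does better. *)
Lemma dist_onb u (s : seq nat) (c : nat -> R) : S u ->
  uniq s -> (forall k, k \in s -> K k) ->
  let w := fun x => u x - \sum_(k <- s) c k * e k x in
  ip w w = ip u u - \sum_(k <- s) ip u (e k) ^+ 2
           + \sum_(k <- s) (c k - ip u (e k)) ^+ 2.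
Proof.
move=> Su us sK /=.
(* Outside s the vectors e k may lie outside S; replace them by zero. *)
pose e' k := if k \in s then e k else fun=> 0.
have Se' k : S (e' k).
  by rewrite /e'; case: ifP => [/sK/Se//|_]; exact: si_zero siP.
have -> : (fun x => u x - \sum_(k <- s) c k * e k x) =
          (fun x => u x - \sum_(k <- s) c k * e' k x).
  apply/funext => x; congr (_ - _); rewrite !big_seq.
  by apply: eq_bigr => k ks; rewrite /e' ks.
rewrite ip_distE//; last exact: si_sum.
rewrite (si_sym siP u) !ip_sum//; last exact: si_sum.
under [X in _ + X = _]eq_bigr do rewrite (si_sym siP) ip_sum//.
have E2 : \sum_(k <- s) c k * (\sum_(j <- s) c j * ip (e' j) (e' k)) =
          \sum_(k <- s) c k ^+ 2.
  rewrite [LHS]big_seq [RHS]big_seq; apply: eq_bigr => k ks.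
  rewrite (bigD1_seq k)//= big_seq_cond big1 ?addr0.
    by rewrite /e' ks ortho ?eqxx ?mulr1 ?expr2//; exact: sK.
  by move=> j /andP[js jk]; rewrite /e' js ks ortho ?(negbTE jk) ?mulr0//;
    exact: sK.
rewrite E2 mulr_sumr -addrA -addrA; congr (_ + _).
rewrite -!sumrN -!big_split/= [LHS]big_seq [RHS]big_seq; apply: eq_bigr => k ks.
by rewrite (si_sym siP u) /e' ks; ring.
Qed.

(** Bessel gives one inequality.  For the other, an approximation of u within eps
    leaves at most eps outside the sum of the squared coefficients, by
    [dist_onb]; the approximating list may repeat indices, so its coefficients
    are first multiplied by the multiplicities. *)
Lemma parseval u : S u ->
  (forall eps : R, 0 < eps ->
     exists (s : seq nat) (c : nat -> R), (forall k, k \in s -> K k) /\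
     let w := fun x => u x - \sum_(k <- s) c k * e k x in ip w w < eps) ->
  (\esum_(k in K) (ip u (e k) ^+ 2)%:E)%E = (ip u u)%:E.
Proof.
move=> Su dense; apply/eqP; rewrite eq_le; apply/andP; split.
  apply: ge_ereal_sup => _ /= [A [finA AK] <-].
  rewrite fsbig_finite//= sumEFin lee_fin.
  set s := (X in \sum_(i <- X) _).
  have sK k : k \in s -> K k by rewrite in_fset_set// => /set_mem/AK.
  have /= := dist_onb (fun k => ip u (e k)) Su (finmap.fset_uniq _) sK.
  set w := fun x => u x - \sum_(k <- s) ip u (e k) * e k x => wE.
  have : 0 <= ip w w.
    apply: (si_ge0 siP); suff : S (fun x => \sum_(k <- s) ip u (e k) * e k x).
      exact: si_sub.
    rewrite (_ : (fun _ => _) = fun x =>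
      \sum_(k <- s) ip u (e k) * (if k \in s then e k else fun=> 0) x).
      by apply: si_sum => k; case: ifP => [/sK/Se//|_]; exact: si_zero siP.
    by apply/funext => x; rewrite !big_seq; apply: eq_bigr => k ->.
  rewrite wE [X in _ + X]big1 ?addr0 ?subr_ge0// => k _.
  by rewrite subrr expr0n.
apply/lee_addgt0Pr => eps /dense[s [c [sK /=]]].
under eq_fun do rewrite -big_undup_iterop_count/=.
pose c' k := c k *+ count_mem k s.
have -> : (fun x => u x - \sum_(i <- undup s) iterop (count_mem i s) +%R (c i * e i
  x) 0) =
          (fun x => u x - \sum_(k <- undup s) c' k * e k x).
  apply/funext => x; congr (_ - _); apply: eq_bigr => k _.
  by rewrite -[iterop _ _ _ _]/(_ *+ _) mulrnAl.
have sK' k : k \in undup s -> K k by rewrite mem_undup; exact: sK.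
have := dist_onb c' Su (undup_uniq s) sK'; rewrite /= => ->.
have d0 : 0 <= \sum_(k <- undup s) (c' k - ip u (e k)) ^+ 2.
  by apply: sumr_ge0 => k _; exact: sqr_ge0.
move=> lt_eps.
apply: (@le_trans _ _ ((\sum_(k <- undup s) ip u (e k) ^+ 2)%:E + eps%:E)%E).
  by rewrite -EFinD lee_fin; lra.
rewrite leeD2r//; apply: ereal_sup_ubound => /=.
exists [set` undup s]; first by split => //= k /=; exact: sK'.
rewrite -fsbig_seq ?undup_uniq//.
by rewrite sumEFin.
Qed.

End parseval.

(** The coefficients form one sequence for all large lengths, so that two
    combinations of different lengths are added coefficientwise. *)
Definition in_span e w := exists (N : nat) (c : nat -> R), forall n, (N <= n)%N ->
  forall x, w x = \sum_(j < n) c j * e j x.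

Lemma in_span_lc e a w1 w2 : in_span e w1 -> in_span e w2 ->
  in_span e (fun x => a * w1 x + w2 x).
Proof.
move=> [N1 [c1 h1]] [N2 [c2 h2]].
exists (maxn N1 N2), (fun j => a * c1 j + c2 j) => n; rewrite geq_max.
move=> /andP[n1 n2] x; rewrite (h1 n)// (h2 n)// mulr_sumr -big_split/=.
by apply: eq_bigr => j _; ring.
Qed.

Lemma in_span0 e : in_span e (fun=> 0).
Proof. by exists 0, (fun=> 0) => n _ x; rewrite big1// => j _; rewrite mul0r. Qed.

Lemma in_span_base e k : in_span e (e k).
Proof.
exists k.+1, (fun j => (j == k)%:R) => n kn x.
rewrite (bigD1 (Ordinal kn))//= eqxx mul1r big1 ?addr0// => j jk.
by rewrite (_ : (j == k :> nat) = false) ?mul0r//; apply/negbTE.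
Qed.

Lemma in_span_sum e (I : Type) (s : seq I) (c : I -> R) (g : I -> T -> R) :
  (forall i, in_span e (g i)) -> in_span e (fun x => \sum_(i <- s) c i * g i x).
Proof.
move=> h; elim: s => [|i s IH].
  by under eq_fun do rewrite big_nil; exact: in_span0.
by under eq_fun do rewrite big_cons; exact: in_span_lc.
Qed.

(** A vector of norm zero is sent to the zero function, the inverse of 0 being 0. *)
Definition normalized u : T -> R := fun x => (Num.sqrt (ip u u))^-1 * u x.

(** [residual b n] is the whole family b made orthogonal to the first n vectors
    of the Gram-Schmidt family.  Carrying the whole family makes the recursion
    structural in n. *)
Fixpoint residual b n : nat -> T -> R :=
  match n with
  | 0 => b
  | n.+1 => let r := residual b n in let e := normalized (r n) in
            fun k x => r k x - ip (r k) e * e x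
  end.

Definition gram_schmidt b n := normalized (residual b n n).

Section gram_schmidt.
Variable b : nat -> T -> R.
Hypothesis Sb : forall k, S (b k).
Local Notation r := (residual b).
Local Notation e := (gram_schmidt b).

Lemma si_scale a u : S u -> S (fun x => a * u x).
Proof.
move=> Su; rewrite (_ : (fun _ => _) = fun x => a * u x + 0).
  by apply: (si_lc siP) => //; exact: si_zero siP.
by apply/funext => x; rewrite addr0.
Qed.

Lemma ipZ a u w : S u -> S w -> ip (fun x => a * u x) w = a * ip u w.
Proof.
move=> Su Sw; rewrite (_ : (fun _ => _) = fun x => a * u x + 0).
  by rewrite si_linear// ?ip0 ?addr0//; exact: si_zero siP.
by apply/funext => x; rewrite addr0.
Qed.

Lemma residual_in n k : S (r n k).
Proof.
by elim: n k => [//|n IH] k /=; apply: si_sub => //; do 2!apply: si_scale => //.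
Qed.

Lemma gram_schmidt_in n : S (e n).
Proof. by apply: si_scale; exact: residual_in. Qed.

Lemma gram_schmidt_null n : ip (r n n) (r n n) = 0 -> e n = fun=> 0.
Proof.
by move=> h; apply/funext => x; rewrite /gram_schmidt /normalized h sqrtr0 invr0 mul0r.
Qed.

Lemma gram_schmidt_unit n : ip (r n n) (r n n) != 0 -> ip (e n) (e n) = 1.
Proof.
move=> h; have Sr := residual_in n n; have r0 := si_ge0 siP Sr.
rewrite ipZ//; last exact: gram_schmidt_in.
rewrite (si_sym siP) ipZ// mulrA -invfM -expr2 sqr_sqrtr//.
by rewrite mulVf.
Qed.

Lemma residual_ortho n k j : (j < n)%N -> ip (r n k) (e j) = 0.
Proof.
elim: n k j => [//|n IH] k j; rewrite ltnS leq_eqVlt => jn /=.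
have [Sr Se] := (residual_in, gram_schmidt_in).
rewrite -/(e n) ipB//; last exact: si_scale.
rewrite [X in _ - X]ipZ//.
case/predU1P: jn => [->|jn].
  have [h|h] := eqVneq (ip (r n n) (r n n)) 0.
    by rewrite gram_schmidt_null// (si_sym siP) ip0//; ring.
  by rewrite gram_schmidt_unit//; ring.
by rewrite IH// [ip (e n) _]ipZ// (IH n)// !mulr0 subr0.
Qed.

Lemma residual_expand n k x :
  b k x = r n k x + \sum_(j < n) ip (r j k) (e j) * e j x.
Proof.
elim: n => [|n IH] /=; first by rewrite big_ord0 addr0.
by rewrite big_ord_recr/= IH -/(e n); ring.
Qed.

(** The k-th vector of the family is exhausted after step k + 1.  Its residual
    need not be the zero function, because ip is only semi-definite. *)
Lemma residual_null k : ip (r k.+1 k) (r k.+1 k) = 0.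
Proof.
have [Sr Se] := (residual_in, gram_schmidt_in).
rewrite [r k.+1 k]/= -/(e k); set c := ip (r k k) (e k).
have Sce := si_scale c (Se k).
have ce_r : ip (r k k) (fun x => c * e k x) = c ^+ 2.
  by rewrite (si_sym siP) ipZ// (si_sym siP) expr2.
have ce_ce : ip (fun x => c * e k x) (fun x => c * e k x) = c ^+ 2 * ip (e k) (e k).
  by rewrite ipZ// (si_sym siP) ipZ// expr2 mulrA.
rewrite ip_distE// ce_r ce_ce.
have [h|h] := eqVneq (ip (r k k) (r k k)) 0.
  have c0 : c = 0 by rewrite /c gram_schmidt_null// (si_sym siP) ip0.
  by rewrite h c0; ring.
rewrite gram_schmidt_unit//.
have -> : ip (r k k) (r k k) = c ^+ 2.
  rewrite /c (si_sym siP _ (e k)) ipZ// exprMn exprVn sqr_sqrtr ?(si_ge0 siP)//.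
  by rewrite expr2 mulrA mulVf ?mul1r.
by ring.
Qed.

(** Sum the expansions [residual_expand] taken at step k + 1 for the k-th vector:
    what remains is a combination of null vectors. *)
Lemma in_span_gram_schmidt w : in_span b w -> exists w' z,
  [/\ in_span e w', S z, ip z z = 0 & w = fun x => w' x + z x].
Proof.
move=> [N [c wE]]; have {wE} -> : w = fun x => \sum_(j < N) c j * b j x.
  by apply/funext => x; exact: wE.
exists (fun x => \sum_(k < N) c k * (\sum_(j < k.+1) ip (r j k) (e j) * e j x)).
exists (fun x => \sum_(k < N) c k * r k.+1 k x).
have Sz : S (fun x => \sum_(k < N) c k * r k.+1 k x).
  by apply: (@si_sum 'I_N _ c (fun k => r k.+1 k)) => k; exact: residual_in.
split => //.
- apply: in_span_sum => k; apply: in_span_sum => j; exact: in_span_base.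
- rewrite (@ip_sum 'I_N _ c (fun k => r k.+1 k))//; last first.
    by move=> k; exact: residual_in.
  rewrite big1// => k _; rewrite (si_sym siP) ip_null ?mulr0//.
    exact: residual_in.
  exact: residual_null.
- apply/funext => x; rewrite -big_split/=; apply: eq_bigr => k _.
  by rewrite (residual_expand k.+1 k x) mulrDr addrC.
Qed.

(** Degenerate steps are discarded through the index set; there the Gram-Schmidt
    vector is the zero function, so no combination is lost. *)
Lemma gram_schmidt_onb :
  (forall u, S u -> forall eps : R, 0 < eps -> exists2 w, in_span b w &
     ip (fun x => u x - w x) (fun x => u x - w x) < eps) ->
  exists K, is_onb K e.
Proof.
move=> dense; exists [set n | ip (r n n) (r n n) != 0]; split => /=.
- by move=> k _; exact: gram_schmidt_in.
- move=> j k Kj Kk; case: (ltngtP j k) => [jk|kj|->]; last exact: gram_schmidt_unit.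
  + rewrite (si_sym siP) ipZ ?residual_ortho ?mulr0//; first exact: residual_in.
    exact: gram_schmidt_in.
  + rewrite ipZ ?residual_ortho ?mulr0//; first exact: residual_in.
    exact: gram_schmidt_in.
- move=> u Su eps /(dense _ Su)[w bw].
  have Sw : S w.
    case: bw => N [c wE]; rewrite (_ : w = fun x => \sum_(j < N) c j * b j x).
      by apply: (@si_sum 'I_N _ c b).
    by apply/funext => x; exact: wE.
  have [w' [z [[N [c ew']] Sz z0 wE]]] := in_span_gram_schmidt bw.
  have Sw' : S w'.
    rewrite (_ : w' = fun x => w x - z x); first exact: si_sub.
    by apply/funext => x; rewrite wE; ring.
  move=> lt_eps; exists [seq j <- iota 0 N | ip (r j j) (r j j) != 0], c; split.
    by move=> k; rewrite mem_filter => /andP[].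
  rewrite [X in ip X X](_ : _ = fun x => u x - w' x); last first.
    apply/funext => x; rewrite (ew' N)// big_filter -(big_mkord xpredT (fun j =>
      c j * e j x)).
    rewrite /index_iota subn0 big_mkcond/=; congr (_ - _).
    apply: eq_bigr => j _; case: ifP => // /negbFE/eqP h.
    by rewrite gram_schmidt_null// mulr0.
  suff <- : ip (fun x => u x - w x) (fun x => u x - w x) =
            ip (fun x => u x - w' x) (fun x => u x - w' x) by [].
  rewrite (_ : (fun x => u x - w x) = fun x => (u x - w' x) - z x); last first.
    by apply/funext => x; rewrite wE; ring.
  have Suw' := si_sub Su Sw'.
  by rewrite [LHS]ip_distE// z0 (ip_null Suw' Sz z0) mulr0 subr0 addr0.
Qed.

End gram_schmidt.
End semi_inner_product.

(** * A countable feature expansion of a continuous kernel *)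

Section cholesky.
Context {R : realType} {T : Type}.
Variable (M : set T).
Implicit Types (k : T -> T -> R).

Definition sym_psd k : Prop :=
  (forall x y, M x -> M y -> k x y = k y x) /\
  (forall n (x : 'I_n -> T) (c : 'I_n -> R), (forall i, M (x i)) ->
     0 <= \sum_(i < n) \sum_(j < n) c i * c j * k (x i) (x j)).

Lemma psd2 k a b x y : sym_psd k -> M x -> M y ->
  0 <= a ^+ 2 * k x x + 2 * (a * b) * k x y + b ^+ 2 * k y y.
Proof.
move=> [kC kp] Mx My.
have := kp 2 (fun i => if i == ord0 then x else y) (fun i => if i == ord0 then a else b).
rewrite !big_ord_recl !big_ord0/= => h; apply: le_trans (h _) _.
  by move=> i; case: ifP.
by rewrite (kC y x)//; lra.
Qed.

Lemma psd_diag k x : sym_psd k -> M x -> 0 <= k x x.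
Proof.
by move=> kp Mx; have := psd2 1 0 kp Mx Mx; lra.
Qed.

(** Otherwise the quadratic form at x and y, linear in the coefficient of y,
    would take negative values. *)
Lemma psd_diag0 k x y : sym_psd k -> M x -> M y -> k y y = 0 -> k x y = 0.
Proof.
move=> kp Mx My ky0; apply/eqP/negPn/negP => kxy.
have := psd2 1 (- (k x x + 1) / (2 * k x y)) kp Mx My; rewrite ky0.
rewrite (_ : 2 * _ * _ = - (k x x + 1)); first by lra.
by field.
Qed.

Definition pivot k z x := k x z / Num.sqrt (k z z).

Definition schur k z x y := k x y - pivot k z x * pivot k z y.

(** The quadratic form of the Schur complement at points x_i is the one of k at
    the same points together with z, where z gets the coefficient that
    minimizes the form. *)
Lemma sym_psd_schur k z : sym_psd k -> M z -> sym_psd (schur k z).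
Proof.
move=> kP Mz; have [kC kp] := kP; split.
  by move=> x y Mx My; rewrite /schur kC// mulrC.
move=> n x c Mx; have kzz := psd_diag kP Mz.
pose d := \sum_(i < n) c i * k (x i) z.
have -> : \sum_(i < n) \sum_(j < n) c i * c j * schur k z (x i) (x j) =
    \sum_(i < n) \sum_(j < n) c i * c j * k (x i) (x j) - d ^+ 2 / k z z.
  rewrite /schur expr2 [in RHS]mulr_suml [in RHS]mulr_suml -sumrB.
  apply: eq_bigr => i _.
  rewrite [in RHS]mulr_sumr [in RHS]mulr_suml -sumrB; apply: eq_bigr => j _.
  rewrite /pivot; have -> : (k z z)^-1 = (Num.sqrt (k z z))^-1 ^+ 2.
    by rewrite exprVn sqr_sqrtr.
  by ring.
have [kzz0|kzz0] := eqVneq (k z z) 0; first by rewrite kzz0 invr0 mulr0 subr0 kp.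
(* The coefficient - d / k z z of z minimizes the quadratic form. *)
pose x' (i : 'I_n.+1) := if unlift ord0 i is Some j then x j else z.
pose c' (i : 'I_n.+1) := if unlift ord0 i is Some j then c j else - d / k z z.
have := kp _ x' c'; rewrite big_ord_recl big_ord_recl.
rewrite (eq_bigr (fun i => - d / k z z * (c i * k (x i) z))); last first.
  by move=> i _; rewrite /x' /c' liftK unlift_none kC//; ring.
rewrite -mulr_sumr -/d.
rewrite [X in _ + X](eq_bigr (fun i => - d / k z z * (c i * k (x i) z) +
  \sum_(j < n) c i * c j * k (x i) (x j))); last first.
  move=> i _; rewrite big_ord_recl /x' /c' liftK unlift_none; congr (_ + _).
    by ring.
  by apply: eq_bigr => j _; rewrite liftK.
rewrite big_split/= -mulr_sumr -/d /x' /c' !unlift_none => h.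
apply: le_trans (h _) _; last by rewrite le_eqVlt; apply/predU1P; left; field.
by move=> i; case: (unlift _ _).
Qed.

Variables (k : T -> T -> R) (z : nat -> T).
Hypotheses (kP : sym_psd k) (Mz : forall n, M (z n)).

Fixpoint chol_residual n : T -> T -> R :=
  if n is n'.+1 then schur (chol_residual n') (z n') else k.

Definition chol n := pivot (chol_residual n) (z n).

Lemma sym_psd_residual n : sym_psd (chol_residual n).
Proof. by elim: n => [|n IH] //=; exact: sym_psd_schur. Qed.

Lemma chol_residualE n x y :
  chol_residual n x y = k x y - \sum_(j < n) chol j x * chol j y.
Proof.
elim: n => [|n IH] /=; first by rewrite big_ord0 subr0.
by rewrite /schur IH big_ord_recr/= -!/(chol n _) opprD addrA.
Qed.

(** Step i eliminates z_i: if the pivot there is 0, the residual already vanishes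
    by positivity ([psd_diag0]).  Later steps subtract multiples of residuals that
    vanish at z_i. *)
Lemma chol_residual_node n i y : (i < n)%N -> M y -> chol_residual n (z i) y = 0.
Proof.
elim: n y => // n IH y; rewrite ltnS leq_eqVlt => /predU1P[->|lt_in] My /=.
  rewrite /schur /pivot; have := sym_psd_residual n; set r := chol_residual n => rP.
  have rzz : 0 <= r (z n) (z n) by exact: psd_diag.
  rewrite (rP.1 (z n) y)//.
  have [h|h] := eqVneq (r (z n) (z n)) 0.
    by rewrite (psd_diag0 rP My (Mz n) h) h; ring.
  rewrite mulrACA -invfM -expr2 sqr_sqrtr//.
  by field.
by rewrite /schur IH// /pivot IH// !mul0r subr0.
Qed.

Lemma chol_sqr_le n x : M x -> \sum_(j < n) chol j x ^+ 2 <= k x x.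
Proof.
move=> Mx; have := psd_diag (sym_psd_residual n) Mx.
by rewrite chol_residualE subr_ge0.
Qed.

(** Since the residual kernel vanishes at z_i, its diagonal at x is the squared
    distance from x to z_i that it induces.  That distance only decreases along
    the algorithm: what was subtracted is a sum of squares. *)
Lemma chol_residual_le n i x : (i < n)%N -> M x ->
  chol_residual n x x <= k x x - 2 * k x (z i) + k (z i) (z i).
Proof.
move=> lt_in Mx; have [rC _] := sym_psd_residual n.
have r1 := chol_residual_node lt_in Mx; rewrite rC// in r1.
have r2 := chol_residual_node lt_in (Mz i).
have : 0 <= \sum_(j < n) (chol j x - chol j (z i)) ^+ 2.
  by apply: sumr_ge0 => j _; exact: sqr_ge0.
have -> : \sum_(j < n) (chol j x - chol j (z i)) ^+ 2 =
   \sum_(j < n) chol j x * chol j x - 2 * \sum_(j < n) chol j x * chol j (z i)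
   + \sum_(j < n) chol j (z i) * chol j (z i).
  by rewrite mulr_sumr -sumrB -big_split/=; apply: eq_bigr => j _; ring.
move: r1 r2; rewrite !chol_residualE; lra.
Qed.

Hypothesis z_dense : forall x, M x -> forall eps : R, 0 < eps ->
  exists i, k x x - 2 * k x (z i) + k (z i) (z i) < eps.

Lemma chol_cvg x y : M x -> M y ->
  (fun n => \sum_(j < n) chol j x * chol j y) @ \oo --> k x y.
Proof.
move=> Mx My; apply/cvgrPdist_lt => eps eps0.
have [i1 h1] := z_dense Mx eps0; have [i2 h2] := z_dense My eps0.
exists (maxn i1 i2).+1 => // n /=; rewrite gtn_max => /andP[n1 n2].
have := chol_residual_le n1 Mx; have := chol_residual_le n2 My.
rewrite -chol_residualE; have rP := sym_psd_residual n.
have := psd2 1 1 rP Mx My; have := psd2 1 (-1) rP Mx My => p1 p2 p3 p4.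
by rewrite ltr_norml; apply/andP; split; lra.
Qed.

(** The Cholesky functions are finite combinations of kernel sections; this form
    transfers any property stable under combinations, such as measurability. *)
Lemma chol_ind (P : set (T -> R)) : (forall y, M y -> P (k ^~ y)) ->
  (forall a u v, P u -> P v -> P (fun x => a * u x + v x)) ->
  forall n, P (chol n).
Proof.
move=> Pk Plc.
suff H n y : M y -> P (chol_residual n ^~ y).
  move=> n; rewrite (_ : chol n = fun x =>
    ((Num.sqrt (chol_residual n (z n) (z n)))^-1 - 1) * chol_residual n x (z n)
    + chol_residual n x (z n)).
    by apply: (Plc _ (chol_residual n ^~ (z n)) (chol_residual n ^~ (z n))); exact: H.
  by apply/funext => x; rewrite /chol /pivot; ring.
elim: n y => [//|n IH] y My /=.
rewrite (_ : _ ^~ y = fun x =>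
  (- pivot (chol_residual n) (z n) y / Num.sqrt (chol_residual n (z n) (z n)))
  * chol_residual n x (z n) + chol_residual n x y).
  by apply: (Plc _ (chol_residual n ^~ (z n)) (chol_residual n ^~ y)); exact: IH.
by apply/funext => x; rewrite /schur /pivot; ring.
Qed.

End cholesky.

(** For every point with rational coordinates and every radius 1 / (n + 1), pick a
    point of M within that radius when there is one. *)
Lemma dense_seq (R : realType) D (M : set (D.-tuple R)) : M !=set0 ->
  exists z : nat -> D.-tuple R, (forall n, M (z n)) /\
  forall x, M x -> forall r : R, 0 < r ->
  exists n, forall i, `|tnth x i - tnth (z n) i| < r.
Proof.
move=> [x0 Mx0].
have pick (c : D.-tuple rat * nat) : exists y, M y /\
    ((exists y', M y' /\ forall i, `|tnth y' i - ratr (tnth c.1 i)| < c.2.+1%:R^-1) ->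
     forall i, `|tnth y i - ratr (tnth c.1 i)| < c.2.+1%:R^-1).
  have [[y' [My' h]]|h] := pselect (exists y', M y' /\
     forall i, `|tnth y' i - ratr (tnth c.1 i)| < c.2.+1%:R^-1 :> R).
    by exists y'.
  by exists x0; split.
have [g gP] := choice pick.
exists (fun m => if unpickle m is Some c then g c else x0); split.
  by move=> m; case: (unpickle m) => [c|//]; exact: (gP c).1.
move=> x Mx r r0.
have [n hn] : exists n : nat, 2 / n.+1%:R < r.
  exists (Num.trunc (2 / r)); rewrite ltr_pdivrMr// mulrC -ltr_pdivrMr//.
  by exact: truncnS_gt.
have e0 : 0 < n.+1%:R^-1 :> R by rewrite invr_gt0.
have [e eE] : exists e : R, e = n.+1%:R^-1 by eexists.
rewrite -eE in hn e0.
have hq i : exists q : rat, `|tnth x i - ratr q| < e :> R.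
  have := @rat_in_itvoo R (tnth x i - e) (tnth x i + e).
  case; first by lra.
  move=> q; rewrite in_itv/= => /andP[q1 q2]; exists q.
  by rewrite ltr_norml; apply/andP; split; lra.
have [q qP] := choice hq.
exists (pickle ([tuple q i | i < D], n)) => i; rewrite pickleK.
have /= := (gP ([tuple q i | i < D], n)).2; rewrite -eE; set y := g _ => h.
have /(_ i) : forall i, `|tnth y i - ratr (tnth [tuple q i | i < D] i)| < e.
  by apply: h; exists x; split => // j; rewrite tnth_mktuple.
have := qP i; rewrite tnth_mktuple !ltr_norml => /andP[a1 a2] /andP[b1 b2].
by apply/andP; split; lra.
Qed.

Section features.
Context {R : realType} {D : nat}.
Local Notation T := (D.-tuple R).
Variables (M : set T) (kappa : T -> T -> R).

Record feature_expansion (B : R) (phi : nat -> T -> R) : Prop := FeatureExpansion {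
  feature_measurable : forall k, measurable_fun M (phi k) ;
  feature_bound : forall n x, M x -> \sum_(k < n) phi k x ^+ 2 <= B ;
  feature_cvg : forall x y, M x -> M y ->
    (fun n => \sum_(k < n) phi k x * phi k y) @ \oo --> kappa x y }.

Lemma measurable_section y : measurable M -> psd_kernel M kappa -> M y ->
  measurable_fun M (kappa ^~ y).
Proof.
move=> mM [mk _ _] My.
apply: (@measurable_comp _ _ _ _ _ _ (M `*` M)
  (fun z : T * T => kappa z.1 z.2) M (fun x => (x, y))) => //.
- exact: measurableX.
- by move=> _ /= [x Mx <-].
- exact: measurable_funTS (pair2_measurable _).
Qed.

Lemma feature_expansion_exists : measurable M -> M !=set0 ->
  psd_kernel M kappa -> continuous_kernel M kappa -> bounded_kernel M kappa ->
  exists B phi, feature_expansion B phi.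
Proof.
move=> mM M0 kP kC [B kB]; have [_ ksym kpsd] := kP.
have [z [Mz zd]] := dense_seq M0.
have kP' : sym_psd M kappa by [].
exists B, (chol kappa z); split.
- move=> n; apply: (chol_ind Mz); first by move=> y; exact: measurable_section.
  move=> a u v mu mv; apply: measurable_funD => //.
  by apply: measurable_funM => //; exact: measurable_cst.
- move=> n x Mx; apply: le_trans (chol_sqr_le kP' Mz n Mx) _.
  exact: le_trans (ler_norm _) (kB _ _ Mx Mx).
- apply: chol_cvg => // x Mx eps eps0.
  have e0 : 0 < eps / 4 by lra.
  have [r r0 hr] := kC x x Mx Mx _ e0.
  have [i hi] := zd x Mx r r0; exists i.
  have h0 j : `|tnth x j - tnth x j| < r by rewrite subrr normr0.
  have := hr _ _ Mx (Mz i) h0 hi; have := hr _ _ (Mz i) (Mz i) hi hi.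
  rewrite !ltr_norml => /andP[a1 a2] /andP[b1 b2]; lra.
Qed.

End features.

(** * Integrals of bounded functions against finite signed measures *)

Section real_dominated_convergence.
Context d (T : measurableType d) (R : realType).
Variables (mu : {measure set T -> \bar R}) (D : set T).
Hypothesis mD : measurable D.

Lemma le_Rintegrable (f g : T -> R) : measurable_fun D f ->
  (forall x, D x -> `|f x| <= g x) -> mu.-integrable D (EFin \o g) ->
  mu.-integrable D (EFin \o f).
Proof.
move=> mf fg; apply: le_integrable => //; first exact/measurable_EFinP.
move=> x Dx /=; rewrite lee_fin; apply: le_trans (fg _ Dx) _; exact: ler_norm.
Qed.

Lemma Rdominated_convergence (f_ : nat -> T -> R) (f g : T -> R) :
  (forall n, measurable_fun D (f_ n)) ->
  (forall x, D x -> f_ ^~ x @ \oo --> f x) ->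
  mu.-integrable D (EFin \o g) ->
  (forall n x, D x -> `|f_ n x| <= g x) ->
  mu.-integrable D (EFin \o f) /\
  \int[mu]_(x in D) f_ n x @[n --> \oo] --> \int[mu]_(x in D) f x.
Proof.
move=> mf_ f_f ig f_g.
have mf := measurable_fun_cvg mf_ f_f.
have [] := @dominated_convergence _ _ _ mu D mD (fun n =>
  EFin \o f_ n) (EFin \o f) (EFin \o g).
- by move=> n; exact/measurable_EFinP.
- exact/measurable_EFinP.
- by apply: aeW => x Dx /=; apply: cvg_EFin; [exact: nearW|exact: f_f].
- exact: ig.
- by apply: aeW => x n Dx /=; rewrite lee_fin f_g.
move=> intf _ h; split => //; apply: fine_cvg; rewrite fineK//.
exact: integrable_fin_num.
Qed.

Lemma Rintegral_sum (I : Type) (s : seq I) (F : I -> T -> R) :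
  (forall i, mu.-integrable D (EFin \o F i)) ->
  mu.-integrable D (EFin \o (fun x => \sum_(i <- s) F i x)) /\
  \int[mu]_(x in D) (\sum_(i <- s) F i x) = \sum_(i <- s) \int[mu]_(x in D) F i x.
Proof.
move=> iF; elim: s => [|i s [IH1 IH2]].
  under [X in _ /\ X = _]eq_Rintegral do rewrite big_nil.
  rewrite big_nil Rintegral_cst// mul0r; split => //.
  under eq_fun do rewrite big_nil; exact: integrable0.
under [X in _ /\ X = _]eq_Rintegral do rewrite big_cons.
rewrite big_cons RintegralD// IH2; split => //.
have := integrableD mD (iF i) IH1; apply: eq_integrable => // x _ /=.
by rewrite big_cons.
Qed.

End real_dominated_convergence.

Section bounded_functionals.
Context d (T : measurableType d) (R : realType).
Variable M : set T.
Hypothesis mM : measurable M.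
Implicit Types (g h : T -> R) (F G : (T -> R) -> R).

Definition bounded_mfun h := measurable_fun M h /\ exists b : R, forall x, M x ->
  `|h x| <= b.

Lemma bounded_mfun_indic A : measurable A -> bounded_mfun \1_A.
Proof.
move=> mA; split; first exact: measurable_indic.
by exists 1 => x _; rewrite indicE; case: (_ \in _); rewrite ?normr1 ?normr0.
Qed.

Lemma bounded_mfun_lc a g h : bounded_mfun g -> bounded_mfun h ->
  bounded_mfun (fun x => a * g x + h x).
Proof.
move=> [mg [b gb]] [mh [c hc]]; split.
  by apply: measurable_funD => //; apply: measurable_funM => //; exact: measurable_cst.
exists (`|a| * b + c) => x Mx; apply: le_trans (ler_normD _ _) _.
by rewrite normrM lerD ?hc// ler_wpM2l// gb.
Qed.

Lemma bounded_mfun0 : bounded_mfun (fun=> 0).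
Proof. by split; [exact: measurable_cst | exists 0 => x _; rewrite normr0]. Qed.

Lemma bounded_mfun_sum (I : Type) (s : seq I) (c : I -> R) (g : I -> T -> R) :
  (forall i, bounded_mfun (g i)) -> bounded_mfun (fun x => \sum_(i <- s) c i * g i x).
Proof.
move=> bg; elim: s => [|i s IH].
  by under eq_fun do rewrite big_nil; exact: bounded_mfun0.
by under eq_fun do rewrite big_cons; exact: bounded_mfun_lc.
Qed.

Lemma bounded_mfun_integrable (mu : {measure set T -> \bar R}) h :
  (mu M < +oo)%E -> bounded_mfun h -> mu.-integrable M (EFin \o h).
Proof.
move=> fM [mh [b hb]]; apply: measurable_bounded_integrable => //.
exists b; split; first exact: num_real.
by move=> c bc x Mx; apply: le_trans (hb _ Mx) (ltW bc).
Qed.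

(** Monotone-class principle: simple functions are combinations of indicators, a
    nonnegative bounded function is a bounded limit of simple functions, and a
    constant is added to reduce to nonnegative functions. *)
Lemma bounded_mfun_ind (P : set (T -> R)) :
  (forall A, measurable A -> P \1_A) ->
  (forall a g h, bounded_mfun g -> bounded_mfun h -> P g -> P h -> P (fun x =>
    a * g x + h x)) ->
  (forall (g_ : nat -> T -> R) h (b : R), (forall n, bounded_mfun (g_ n)) ->
     (forall n x, M x -> `|g_ n x| <= b) ->
     (forall x, M x -> g_ ^~ x @ \oo --> h x) ->
     (forall n, P (g_ n)) -> P h) ->
  forall h, bounded_mfun h -> P h.
Proof.
move=> Pindic Plc Plim.
have P0 : P (fun=> 0).
  rewrite (_ : (fun _ => _) = \1_(@set0 T)); first exact: Pindic.
  by apply/funext => x; rewrite indicE in_set0.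
have Psum (I : Type) (s : seq I) (c : I -> R) (g : I -> T -> R) :
    (forall i, bounded_mfun (g i)) -> (forall i, P (g i)) -> P (fun x =>
      \sum_(i <- s) c i * g i x).
  move=> bg Pg; elim: s => [|i s IH].
    by under eq_fun do rewrite big_nil; exact: P0.
  by under eq_fun do rewrite big_cons; apply: Plc => //; exact: bounded_mfun_sum.
have Ppos h : bounded_mfun h -> (forall x, M x -> 0 <= h x) -> P h.
  move=> [mh [b hb]] h0.
  have mEh : measurable_fun M (EFin \o h) by exact/measurable_EFinP.
  have h0' x : M x -> (0 <= (EFin \o h) x)%E by move=> Mx; rewrite lee_fin h0.
  pose g := nnsfun_approx mM mEh.
  have gcvg x : M x -> (fun n => g n x) @ \oo --> h x.
    move=> Mx; have /= := cvg_nnsfun_approx mM mEh h0' Mx.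
    by move=> /fine_cvg.
  have gb n x : M x -> `|g n x| <= b.
    move=> Mx; rewrite ger0_norm//.
    have : ((g n x)%:E <= (EFin \o h) x)%E by rewrite nnsfun_approxE; exact: le_approx.
    by rewrite lee_fin => /le_trans; apply; apply: le_trans (hb _ Mx); exact: ler_norm.
  have Pg n : bounded_mfun (g n) /\ P (g n).
    have -> : (g n : T -> R) = fun x =>
      \sum_(y <- finmap.enum_fset (fset_set (range (g n))))
        y * \1_(g n @^-1` [set y]) x.
      by apply/funext => x; rewrite fimfunE fsbig_finite.
    have bi y : bounded_mfun (\1_(g n @^-1` [set y])) by apply: bounded_mfun_indic.
    by split; [exact: bounded_mfun_sum | apply: Psum => // y; exact: Pindic].
  by apply: (Plim (fun n => g n : T -> R) h b) => // n; have [] := Pg n.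
move=> h bh; have [mh [b hb]] := bh.
have bT : bounded_mfun \1_(@setT T) by exact: bounded_mfun_indic.
(* Shift h by its bound b to make it nonnegative. *)
rewrite (_ : h = fun x => (- b) * \1_(@setT T) x + (b * \1_(@setT T) x + h x));
  last first.
  by apply/funext => x; rewrite addrA mulNr addNr add0r.
have bhb := bounded_mfun_lc b bT bh.
apply: Plc => //; first exact: Pindic.
apply: Ppos => // x Mx; rewrite indicE in_setT mulr1.
by have := hb _ Mx; rewrite ler_norml => /andP[]; lra.
Qed.

(** The two properties of an integral that determine it from its values on
    indicators.  Identities between integrals against signed measures, whose
    Jordan decompositions do not behave well under sums, are proved by checking
    indicators ([sigma_functional_ext]). *)
Definition sigma_functional F :=
  (forall a g h, bounded_mfun g -> bounded_mfun h -> F (fun x => a * g x + h x) =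
    a * F g + F h) /\
  (forall (g_ : nat -> T -> R) h (b : R), (forall n, bounded_mfun (g_ n)) ->
     (forall n x, M x -> `|g_ n x| <= b) ->
     (forall x, M x -> g_ ^~ x @ \oo --> h x) -> F (g_ n) @[n --> \oo] --> F h).

Lemma sigma_functional_ext F G : sigma_functional F -> sigma_functional G ->
  (forall A, measurable A -> F \1_A = G \1_A) -> forall h, bounded_mfun h -> F h = G h.
Proof.
move=> [Flc Fcvg] [Glc Gcvg] FG; apply: bounded_mfun_ind => // [a g h bg bh Fg Fh|].
  by rewrite Flc// Glc// Fg Fh.
move=> g_ h b bg gb gh FGg.
have F1 := Fcvg g_ h b bg gb gh; have G1 := Gcvg g_ h b bg gb gh.
have FGE : (fun n => F (g_ n)) = (fun n => G (g_ n)).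
  by apply/funext => n; rewrite FGg.
by apply: (cvg_unique _ F1) => //; rewrite FGE.
Qed.

Lemma sigma_functional_lc a F G : sigma_functional F -> sigma_functional G ->
  sigma_functional (fun h => a * F h + G h).
Proof.
move=> [Flc Fcvg] [Glc Gcvg]; split.
  by move=> c g h bg bh; rewrite Flc// Glc//; ring.
move=> g_ h b bg gb gh; apply: cvgD; last exact: Gcvg gb gh.
by apply: cvgM; [exact: cvg_cst|exact: Fcvg gb gh].
Qed.

Lemma sigma_functional0 F : sigma_functional F -> F (fun=> 0) = 0.
Proof.
move=> [Flc _]; have := Flc (-1) (fun=> 0) (fun=> 0) bounded_mfun0 bounded_mfun0.
rewrite [X in F X](_ : _ = fun=> 0); last by apply/funext => x; ring.
by lra.
Qed.

Lemma sigma_functional_sum (I : Type) (s : seq I) (c : I -> R) (g : I -> T -> R) F :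
  sigma_functional F -> (forall i, bounded_mfun (g i)) ->
  F (fun x => \sum_(i <- s) c i * g i x) = \sum_(i <- s) c i * F (g i).
Proof.
move=> sF bg; elim: s => [|i s IH].
  by under eq_fun do rewrite big_nil; rewrite big_nil sigma_functional0.
under eq_fun do rewrite big_cons; rewrite big_cons sF.1 ?IH//.
exact: bounded_mfun_sum.
Qed.

Lemma sigma_functional_int (mu : {measure set T -> \bar R}) : (mu M < +oo)%E ->
  sigma_functional (fun h => \int[mu]_(x in M) h x).
Proof.
move=> fM; split.
  move=> a g h bg bh.
  have ig := bounded_mfun_integrable fM bg; have ih := bounded_mfun_integrable fM bh.
  rewrite RintegralD ?RintegralZl//.
  exact: (@integrableZl _ _ _ mu M mM a (EFin \o g)).
move=> g_ h b bg gb gh.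
have bb : bounded_mfun (fun x => b * \1_(@setT T) x + 0) by apply: bounded_mfun_lc;
  [exact: bounded_mfun_indic|exact: bounded_mfun0].
have mg n : measurable_fun M (g_ n) by have [] := bg n.
apply: (Rdominated_convergence mM mg gh (bounded_mfun_integrable fM bb) _).2.
by move=> n x Mx; rewrite indicE in_setT mulr1 addr0 gb.
Qed.

Lemma Rintegral_indic (mu : {measure set T -> \bar R}) A : measurable A ->
  \int[mu]_(x in M) \1_A x = fine (mu (A `&` M)) :> R.
Proof. by move=> mA; rewrite /Rintegral integral_indic. Qed.

Section charge.
Local Notation signed := (charge T R).
Implicit Types nu : signed.

(** Real-valued form of [charge_integral], with the same value on bounded
    measurable functions. *)
Definition charge_int nu h : R :=
  \int[jordan_pos (hahnP nu)]_(x in M) h x - \int[jordan_neg (hahnP nu)]_(x in M) h x.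

Lemma jordan_pos_fin nu : (jordan_pos (hahnP nu) M < +oo)%E.
Proof. by rewrite ltey_eq fin_num_measure. Qed.

Lemma jordan_neg_fin nu : (jordan_neg (hahnP nu) M < +oo)%E.
Proof. by rewrite ltey_eq fin_num_measure. Qed.

Lemma charge_integralE nu h : bounded_mfun h ->
  charge_integral nu M (EFin \o h) = (charge_int nu h)%:E.
Proof.
move=> bh; rewrite /charge_integral /charge_int EFinB !fineK//;
  apply: integrable_fin_num => //.
  exact: bounded_mfun_integrable (jordan_neg_fin nu) bh.
exact: bounded_mfun_integrable (jordan_pos_fin nu) bh.
Qed.

Lemma eq_charge_integral nu (g h : T -> \bar R) : {in M, g =1 h} ->
  charge_integral nu M g = charge_integral nu M h.
Proof. by move=> gh; rewrite /charge_integral; congr (_ - _)%E; exact: eq_integral. Qed.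

Lemma sigma_functional_charge_int nu : sigma_functional (charge_int nu).
Proof.
rewrite (_ : charge_int nu = fun h => (-1) * (\int[jordan_neg (hahnP nu)]_(x in M) h x)
                                + \int[jordan_pos (hahnP nu)]_(x in M) h x).
  by apply: sigma_functional_lc; apply: sigma_functional_int;
    [exact: jordan_neg_fin|exact: jordan_pos_fin].
by apply/funext => h; rewrite mulN1r addrC.
Qed.

Lemma charge_int_indic nu A : measurable A -> charge_int nu \1_A = fine (nu (A `&` M)).
Proof.
move=> mA; rewrite /charge_int !Rintegral_indic//.
have mAM : measurable (A `&` M) by exact: measurableI.
rewrite (jordan_decomp (hahnP nu) mAM) /cadd/= cscaleN1.
by rewrite fineB// fin_num_measure.
Qed.

(** The constant C is the total variation of nu on M. *)
Lemma charge_int_bound nu : exists2 C : R, 0 <= C & forall h b, measurable_fun M h ->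
  (forall x, M x -> `|h x| <= b) -> `|charge_int nu h| <= b * C.
Proof.
exists (fine (jordan_pos (hahnP nu) M) + fine (jordan_neg (hahnP nu) M)).
  by rewrite addr_ge0// fine_ge0.
move=> h b mh hb; have bh : bounded_mfun h by split => //; exists b.
have H (mu : {measure set T -> \bar R}) : (mu M < +oo)%E ->
    `|\int[mu]_(x in M) h x| <= b * fine (mu M).
  move=> fM; have ih := bounded_mfun_integrable fM bh.
  apply: le_trans (le_normr_Rintegral mM ih) _.
  rewrite -(Rintegral_cst mu mM); apply: le_Rintegral => //.
    exact: integrable_norm.
  apply: (@bounded_mfun_integrable mu (fun=> b)) => //.
  by split; [exact: measurable_cst|exists `|b|].
rewrite mulrDr; apply: le_trans (ler_normB _ _) _.
by apply: lerD; apply: H; [exact: jordan_pos_fin|exact: jordan_neg_fin].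
Qed.

Lemma charge_int_cplus nu1 nu2 h : bounded_mfun h ->
  charge_int (cplus nu1 nu2) h = charge_int nu1 h + charge_int nu2 h.
Proof.
rewrite -[charge_int nu1 h]mul1r; move: h; apply: sigma_functional_ext.
- exact: sigma_functional_charge_int.
- by apply: (@sigma_functional_lc 1); exact: sigma_functional_charge_int.
move=> A mA; rewrite !charge_int_indic// mul1r -fineD// fin_num_measure//;
  exact: measurableI.
Qed.

Lemma charge_int_ctimes a nu h : bounded_mfun h -> charge_int (ctimes a nu) h =
  a * charge_int nu h.
Proof.
rewrite -[RHS]addr0; move: h; apply: sigma_functional_ext.
- exact: sigma_functional_charge_int.
- apply: (@sigma_functional_lc a _ (fun=> 0)); first exact: sigma_functional_charge_int.
  split; first by move=> *; rewrite mulr0 addr0.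
  by move=> *; exact: cvg_cst.
move=> A mA; rewrite !charge_int_indic// addr0 /ctimes/= /cscale/= fineM//
  fin_num_measure//;
  exact: measurableI.
Qed.

Lemma charge_int_csub nu1 nu2 h : bounded_mfun h -> charge_int (csub nu1 nu2) h =
  charge_int nu1 h - charge_int nu2 h.
Proof.
rewrite [RHS]addrC -mulN1r; move: h; apply: sigma_functional_ext.
- exact: sigma_functional_charge_int.
- by apply: sigma_functional_lc; exact: sigma_functional_charge_int.
move=> A mA; have mAM := measurableI _ _ mA mM; rewrite !charge_int_indic//.
rewrite mulN1r addrC -fineB ?fin_num_measure//.
Qed.

Lemma charge_int_clincomb m (c : 'I_m -> R) (nu : 'I_m -> signed) h : bounded_mfun h ->
  charge_int (clincomb c nu) h = \sum_(i < m) c i * charge_int (nu i) h.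
Proof.
move=> bh; apply: (big_ind2 (fun (mu : signed) y => charge_int mu h = y)) => //.
- move: h bh; apply: sigma_functional_ext; first exact: sigma_functional_charge_int.
    by split; [move=> *; rewrite mulr0 addr0 | move=> *; exact: cvg_cst].
  by move=> A mA; rewrite charge_int_indic.
- by move=> mu1 y1 mu2 y2 <- <-; exact: charge_int_cplus.
- by move=> i _; exact: charge_int_ctimes.
Qed.

End charge.
End bounded_functionals.

(** * The embedding inner product in coordinates *)

Section embedded_inner_product.
Context {R : realType} {D : nat}.
Local Notation T := (D.-tuple R).
Local Notation signed := (charge T R).
Variables (M : set T) (kappa : T -> T -> R) (B : R) (phi : nat -> T -> R).
Hypotheses (mM : measurable M) (feat : feature_expansion M kappa B phi).
Implicit Types nu : signed.

Lemma bounded_mfun_feature k : bounded_mfun M (phi k).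
Proof.
split; first exact: (feature_measurable feat k).
(* From t^2 <= B follows |t| <= B + 1. *)
exists (B + 1) => x Mx; have := feature_bound feat k.+1 Mx.
rewrite big_ord_recr/= => h.
have : 0 <= \sum_(i < k) phi i x ^+ 2 by apply: sumr_ge0 => i _; exact: sqr_ge0.
by rewrite ler_norml => h'; apply/andP; split; nra.
Qed.

Lemma feature_partial_bound n x y : M x -> M y ->
  `|\sum_(k < n) phi k x * phi k y| <= B.
Proof.
move=> Mx My; have hx := feature_bound feat n Mx; have hy := feature_bound feat n My.
apply: le_trans (ler_norm_sum _ _ _) _.
apply: (@le_trans _ _ (\sum_(k < n) (phi k x ^+ 2 + phi k y ^+ 2) / 2)).
  apply: ler_sum => k _; rewrite normrM.
  have := sqr_ge0 (`|phi k x| - `|phi k y|).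
  by rewrite sqrrB !real_normK ?num_real//; lra.
by rewrite -mulr_suml big_split/=; lra.
Qed.

Lemma norm_lim_le (u : nat -> R) (l b : R) : (forall n, `|u n| <= b) -> u @ \oo --> l ->
  `|l| <= b.
Proof.
move=> ub ul; apply: (ler_cvg_to (cvg_norm ul) (cvg_cst b)).
by apply: nearW => n; exact: ub.
Qed.

Lemma bounded_mfun_section y : M y -> bounded_mfun M (kappa ^~ y).
Proof.
move=> My; split.
  apply: (@measurable_fun_cvg _ _ _ _ (fun n x => \sum_(k < n) phi k y * phi k x)).
    by move=> n; have [] := bounded_mfun_sum (index_enum 'I_n) (fun k =>
      phi k y) (fun k => bounded_mfun_feature k).
  move=> x Mx; rewrite (_ : (fun n => _) = fun n => \sum_(k < n) phi k x * phi k y).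
    exact: feature_cvg feat _ _ Mx My.
  by apply/funext => n; apply: eq_bigr => k _; rewrite mulrC.
exists B => x Mx; apply: (norm_lim_le _ (feature_cvg feat Mx My)) => n.
exact: feature_partial_bound.
Qed.

Lemma kernel_bound x y : M x -> M y -> `|kappa x y| <= B.
Proof.
move=> Mx My; apply: (norm_lim_le _ (feature_cvg feat Mx My)) => n.
exact: feature_partial_bound.
Qed.

(** The k-th coordinate of the embedding of nu. *)
Definition feature_coef k nu : R := charge_int M nu (phi k).

Definition embedded nu (y : T) : R := charge_int M nu (kappa ^~ y).

(** Real-valued form of [innerE]. *)
Definition inner nu nu' : R := charge_int M nu' (embedded nu).

Lemma partial_embeddedE nu n y :
  \sum_(k < n) feature_coef k nu * phi k y = charge_int M nu (fun x =>
    \sum_(k < n) phi k y * phi k x).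
Proof.
rewrite (sigma_functional_sum (index_enum 'I_n) (fun k => phi k y)
  (sigma_functional_charge_int mM nu) (fun k => bounded_mfun_feature k)).
by apply: eq_bigr => k _; rewrite mulrC.
Qed.

Lemma embedded_cvg nu y : M y -> (fun n =>
  \sum_(k < n) feature_coef k nu * phi k y) @ \oo --> embedded nu y.
Proof.
move=> My; under eq_fun do rewrite partial_embeddedE.
apply: ((sigma_functional_charge_int mM nu).2 (fun n x =>
  \sum_(k < n) phi k y * phi k x) _ B).
- by move=> n; exact: (bounded_mfun_sum (index_enum 'I_n) (fun k =>
  phi k y) (fun k => bounded_mfun_feature k)).
- by move=> n x Mx; exact: feature_partial_bound.
- move=> x Mx; rewrite (_ : (fun n => _) = fun n => \sum_(k < n) phi k x * phi k y).
    exact: feature_cvg feat _ _ Mx My.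
  by apply/funext => n; apply: eq_bigr => k _; rewrite mulrC.
Qed.

(** The partial sums are integrals over nu of partial sums of the kernel, hence
    bounded uniformly in n and y; dominated convergence against the second measure
    of an inner product rests on this bound. *)
Lemma partial_embedded_bound nu : exists b : R, forall n y, M y ->
  `|\sum_(k < n) feature_coef k nu * phi k y| <= b.
Proof.
have [C C0 hC] := charge_int_bound mM nu; exists (B * C) => n y My.
rewrite partial_embeddedE; apply: hC.
  by have [] := bounded_mfun_sum (index_enum 'I_n) (fun k => phi k y) (fun k =>
    bounded_mfun_feature k).
by move=> x Mx; exact: feature_partial_bound.
Qed.

Lemma bounded_mfun_embedded nu : bounded_mfun M (embedded nu).
Proof.
split.
  apply: (@measurable_fun_cvg _ _ _ _ (fun n y =>
    \sum_(k < n) feature_coef k nu * phi k y)).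
    move=> n; by have [] := bounded_mfun_sum (index_enum 'I_n) (fun k =>
      feature_coef k nu) (fun k => bounded_mfun_feature k).
  by move=> y; exact: embedded_cvg.
have [b hb] := partial_embedded_bound nu; exists b => y My.
exact: (@norm_lim_le _ (embedded nu y) b (fun n => hb n y My) (@embedded_cvg nu y My)).
Qed.

Lemma inner_cvg nu nu' :
  (fun n => \sum_(k < n) feature_coef k nu * feature_coef k nu') @ \oo --> inner nu nu'.
Proof.
have [b hb] := partial_embedded_bound nu.
rewrite (_ : (fun n => _) = fun n => charge_int M nu' (fun y =>
  \sum_(k < n) feature_coef k nu * phi k y)).
  apply: ((sigma_functional_charge_int mM nu').2
    (fun n y => \sum_(k < n) feature_coef k nu * phi k y) _ b _ hb); last first.
    by move=> y; exact: embedded_cvg.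
  move=> n; exact: (bounded_mfun_sum (index_enum 'I_n) (fun k =>
    feature_coef k nu) (fun k => bounded_mfun_feature k)).
apply/funext => n.
by rewrite (sigma_functional_sum (index_enum 'I_n) (fun k => feature_coef k nu)
  (sigma_functional_charge_int mM nu') (fun k => bounded_mfun_feature k)).
Qed.

Lemma innerEE nu nu' : innerE M kappa nu nu' = (inner nu nu')%:E.
Proof.
rewrite /inner -(charge_integralE mM nu' (bounded_mfun_embedded nu));
  apply: eq_charge_integral.
move=> y /set_mem My.
by rewrite /embedding (charge_integralE mM nu (bounded_mfun_section My)).
Qed.

Lemma inner_sym nu nu' : inner nu nu' = inner nu' nu.
Proof.
have h1 := @inner_cvg nu nu'.
have h2 : (fun n => \sum_(k < n) feature_coef k nu * feature_coef k nu') @ \oo -->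
  inner nu' nu.
  under eq_fun do under eq_bigr do rewrite mulrC.
  exact: inner_cvg.
exact: (cvg_unique (@Rhausdorff R) h1 h2).
Qed.

Lemma norm2E_series nu : norm2E M kappa nu = (\sum_(k <oo) (feature_coef k nu ^+ 2)%:E)%E.
Proof.
rewrite /norm2E innerEE; apply/esym/cvg_lim => //.
rewrite (_ : (fun n => _) = EFin \o (fun n =>
  \sum_(k < n) feature_coef k nu * feature_coef k nu)).
  by apply: cvg_EFin; [exact: nearW|exact: inner_cvg].
by apply/funext => n; rewrite /= sumEFin big_mkord.
Qed.

Lemma inner_csubr nu nu1 nu2 : inner nu (csub nu1 nu2) = inner nu nu1 - inner nu nu2.
Proof. exact: charge_int_csub (bounded_mfun_embedded nu). Qed.

Lemma inner_clincombr nu m (c : 'I_m -> R) (nus : 'I_m -> signed) :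
  inner nu (clincomb c nus) = \sum_(i < m) c i * inner nu (nus i).
Proof. exact: charge_int_clincomb (bounded_mfun_embedded nu). Qed.

End embedded_inner_product.

(** * The weighted space L2(1/rho0) and operators given by coordinate functions *)

Section weighted_L2.
Context {R : realType} {D : nat}.
Local Notation T := (D.-tuple R).
Local Notation leb := (lebesgue_tuple R D).
Variables (M : set T) (rho0 : T -> R).
Hypotheses (mM : measurable M) (dens : prob_density M rho0).
Implicit Types (u v f G : T -> R).

Let rho_ge0 x : M x -> 0 <= rho0 x. Proof. by move: x; have [] := dens. Qed.
Let mrho : measurable_fun M rho0. Proof. by have [] := dens. Qed.

(** The inverse is measurable as a real power, which agrees with it on
    nonnegative numbers, 0 included. *)
Lemma measurable_rhoV : measurable_fun M (fun x => (rho0 x)^-1).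
Proof.
apply: (eq_measurable_fun (fun x => rho0 x `^ (-1))).
  by move=> x /set_mem Mx; rewrite powR_inv1// rho_ge0.
by apply: (@measurableT_comp _ _ _ _ _ _ (@powR R ^~ (-1))) => //; exact: measurable_powR.
Qed.

Lemma rho_integrable : leb.-integrable M (EFin \o rho0).
Proof.
apply/integrableP; split; first exact/measurable_EFinP.
under eq_integral => x /set_mem Mx do rewrite /= ger0_norm ?rho_ge0//.
by have [_ _ ->] := dens; exact: ltry.
Qed.

Lemma ge0_lty_integrable f : measurable_fun M f -> (forall x, M x -> 0 <= f x) ->
  (\int[leb]_(x in M) (f x)%:E < +oo)%E -> leb.-integrable M (EFin \o f).
Proof.
move=> mf f0 foo; apply/integrableP; split; first exact/measurable_EFinP.
by under eq_integral => x /set_mem Mx do rewrite /= ger0_norm ?f0//.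
Qed.

Lemma L2rho_sqr_integrable u : L2rho M rho0 u ->
  leb.-integrable M (EFin \o (fun x => u x ^+ 2 / rho0 x)).
Proof.
move=> [mu _ uoo]; apply: ge0_lty_integrable => //.
  by apply: measurable_funM; [exact: measurable_funX|exact: measurable_rhoV].
by move=> x Mx; rewrite divr_ge0 ?sqr_ge0 ?rho_ge0.
Qed.

(** By |u v| <= (u^2 + v^2) / 2. *)
Lemma inner_rho_integrable u v : L2rho M rho0 u -> L2rho M rho0 v ->
  leb.-integrable M (EFin \o (fun x => u x * v x / rho0 x)).
Proof.
move=> Lu Lv; have [mu _ _] := Lu; have [mv _ _] := Lv.
apply: (@le_Rintegrable _ _ _ leb M mM _ (fun x =>
  u x ^+ 2 / rho0 x + v x ^+ 2 / rho0 x)).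
- by apply: measurable_funM; [exact: measurable_funM|exact: measurable_rhoV].
- move=> x Mx; have : 0 <= (rho0 x)^-1 by rewrite invr_ge0 rho_ge0.
  move: (rho0 x)^-1 => r r0; rewrite normrM (ger0_norm r0) normrM -mulrDl ler_wpM2r//.
  have := sqr_ge0 (`|u x| - `|v x|); rewrite sqrrB !real_normK ?num_real//.
  by have := sqr_ge0 (u x); have := sqr_ge0 (v x); lra.
- have := integrableD mM (L2rho_sqr_integrable Lu) (L2rho_sqr_integrable Lv).
  by apply: eq_integrable.
Qed.

(** By (a u + v)^2 <= 2 a^2 u^2 + 2 v^2. *)
Lemma L2rho_lc a u v : L2rho M rho0 u -> L2rho M rho0 v ->
  L2rho M rho0 (fun x => a * u x + v x).
Proof.
move=> Lu Lv; have [mu u0 _] := Lu; have [mv v0 _] := Lv.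
have mw : measurable_fun M (fun x => a * u x + v x).
  by apply: measurable_funD => //; apply: measurable_funM => //; exact: measurable_cst.
split => //.
  apply: filterS2 u0 v0 => x hu hv Mx rx.
  by rewrite hu// hv// mulr0 addr0.
have iw : leb.-integrable M (EFin \o (fun x => (a * u x + v x) ^+ 2 / rho0 x)).
  apply: (@le_Rintegrable _ _ _ leb M mM _
    (fun x => 2 * a ^+ 2 * (u x ^+ 2 / rho0 x) + 2 * (v x ^+ 2 / rho0 x))).
  - by apply: measurable_funM; [exact: measurable_funX|exact: measurable_rhoV].
  - move=> x Mx; have : 0 <= (rho0 x)^-1 by rewrite invr_ge0 rho_ge0.
    move: (rho0 x)^-1 => r r0; rewrite ger0_norm; last by rewrite mulr_ge0// sqr_ge0.
    rewrite !mulrA -mulrDl ler_wpM2r//.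
    by have := sqr_ge0 (a * u x - v x); nra.
  - have := integrableD mM (integrableZl mM (2 * a ^+ 2) (L2rho_sqr_integrable Lu))
              (integrableZl mM 2 (L2rho_sqr_integrable Lv)).
    by apply: eq_integrable.
have /integrableP[_] := iw; apply: le_lt_trans.
under eq_integral => x /set_mem Mx.
  rewrite -[X in X%:E]ger0_norm; last by rewrite divr_ge0 ?sqr_ge0 ?rho_ge0.
  over.
by [].
Qed.

Lemma L2rho0 : L2rho M rho0 (fun=> 0).
Proof.
split; first exact: measurable_cst.
  exact: aeW.
under eq_integral do rewrite expr0n mul0r.
by rewrite integral0 ltry.
Qed.

Lemma semi_inner_L2rho : semi_inner (L2rho M rho0) (inner_rho M rho0).
Proof.
split.
- exact: L2rho_lc.
- move=> a u v w Lu Lv Lw; rewrite /inner_rho.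
  have iu := inner_rho_integrable Lu Lw; have iv := inner_rho_integrable Lv Lw.
  rewrite -(RintegralZl _ mM iu) -RintegralD//.
    by apply: eq_Rintegral => x _; ring.
  have := integrableZl mM a iu; exact: eq_integrable.
- by move=> u v; apply: eq_Rintegral => x _; rewrite (mulrC (u x)).
- move=> u Lu; apply: Rintegral_ge0 => x Mx.
  by rewrite divr_ge0 ?rho_ge0// -expr2 sqr_ge0.
- exact: L2rho0.
Qed.

Lemma inner_rhoE u v : L2rho M rho0 u -> L2rho M rho0 v ->
  (inner_rho M rho0 u v)%:E = (\int[leb]_(x in M) (u x * v x / rho0 x)%:E)%E.
Proof.
move=> Lu Lv; rewrite /inner_rho /Rintegral fineK//.
exact: integrable_fin_num (inner_rho_integrable Lu Lv).
Qed.

(** The space L2(rho0); multiplication by rho0 maps it isometrically into the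
    space L2(1/rho0) ([L2rho_weight], [inner_rho_sqr]). *)
Definition square_integrable G := measurable_fun M G /\
  (\int[leb]_(x in M) (G x ^+ 2 * rho0 x)%:E < +oo)%E.

Lemma rho_sqrE (a r : R) : (a * r) ^+ 2 / r = a ^+ 2 * r.
Proof.
have [->|r0] := eqVneq r 0; first by rewrite !mulr0 expr0n mul0r.
by field.
Qed.

Lemma L2rho_weight G : square_integrable G -> L2rho M rho0 (fun x => G x * rho0 x).
Proof.
move=> [mG Goo]; split; first exact: measurable_funM.
  by apply: aeW => x _ ->; rewrite mulr0.
by under eq_integral do rewrite rho_sqrE.
Qed.

Lemma inner_rho_sqr G : square_integrable G ->
  (inner_rho M rho0 (fun x => (G x * rho0 x)%R) (fun x => (G x * rho0 x)%R))%:E =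
  (\int[leb]_(x in M) (G x ^+ 2 * rho0 x)%:E)%E.
Proof.
move=> sG; have L := L2rho_weight sG; rewrite inner_rhoE//.
by apply: eq_integral => x _; rewrite -expr2 rho_sqrE.
Qed.

(** The two functions differ only where rho0 vanishes, and there u vanishes
    almost everywhere. *)
Lemma ae_weight u G : L2rho M rho0 u ->
  ae_eq leb M (EFin \o (fun x => u x * (G x * rho0 x) / rho0 x))
              (EFin \o (fun x => u x * G x)).
Proof.
move=> [_ u0 _]; apply: filterS u0 => x /= h Mx; congr EFin.
have [r0|r0] := eqVneq (rho0 x) 0; first by rewrite h// !mul0r.
by field.
Qed.

Lemma L2rho_pair_integrable u G : L2rho M rho0 u -> square_integrable G ->
  leb.-integrable M (EFin \o (fun x => u x * G x)).
Proof.
move=> Lu sG; have [mu _ _] := Lu; have [mG _] := sG.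
have LG := L2rho_weight sG; have [mGr _ _] := LG.
have /integrableP[m1 ioo] := inner_rho_integrable Lu LG.
have m2 : measurable_fun M (EFin \o (fun x => u x * G x)).
  by apply/measurable_EFinP; exact: measurable_funM.
apply/integrableP; split => //.
rewrite (ge0_ae_eq_integral _ _ _ _ _ _ (f := fun x => `|(u x * G x)%:E|%E)
  (g := fun x => `|(u x * (G x * rho0 x) / rho0 x)%:E|%E))//.
- exact: measurableT_comp.
- exact: measurableT_comp.
- by apply: filterS (ae_weight G Lu) => x h Mx; exact: (congr1 abse (esym (h Mx))).
Qed.

Lemma inner_rho_weight u G : L2rho M rho0 u -> square_integrable G ->
  inner_rho M rho0 u (fun x => G x * rho0 x) = \int[leb]_(x in M) (u x * G x).
Proof.
move=> Lu sG; congr fine; apply: ae_eq_integral => //.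
- have LG := L2rho_weight sG.
  by have /integrableP[] := inner_rho_integrable Lu LG.
- by have /integrableP[] := L2rho_pair_integrable Lu sG.
- exact: ae_weight.
Qed.

Lemma square_integrable_bounded G : bounded_mfun M G -> square_integrable G.
Proof.
move=> [mG [b hb]]; split => //.
have : leb.-integrable M (EFin \o (fun x => G x ^+ 2 * rho0 x)).
  apply: (@le_Rintegrable _ _ _ leb M mM _ (fun x => b ^+ 2 * rho0 x)).
  - by apply: measurable_funM => //; exact: measurable_funX.
  - move=> x Mx; rewrite ger0_norm; last by rewrite mulr_ge0 ?sqr_ge0 ?rho_ge0.
    rewrite ler_wpM2r ?rho_ge0// -real_normK ?num_real//.
    by rewrite lerXn2r ?nnegrE// ?hb//; apply: le_trans (hb _ Mx).
  - by have := integrableZl mM (b ^+ 2) rho_integrable; exact: eq_integrable.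
move=> /integrableP[_]; apply: le_lt_trans.
under eq_integral => x /set_mem Mx.
  rewrite -[X in X%:E]ger0_norm; last by rewrite mulr_ge0 ?sqr_ge0 ?rho_ge0.
  over.
by [].
Qed.

Lemma square_integrable_mul G1 G2 : square_integrable G1 -> square_integrable G2 ->
  leb.-integrable M (EFin \o (fun x => G1 x * G2 x * rho0 x)).
Proof.
move=> s1 s2; have := L2rho_pair_integrable (L2rho_weight s1) s2.
by apply: eq_integrable => // x _ /=; congr EFin; ring.
Qed.

Lemma square_integrable_lc a G1 G2 : square_integrable G1 -> square_integrable G2 ->
  square_integrable (fun x => a * G1 x + G2 x).
Proof.
move=> s1 s2; have [m1 _] := s1; have [m2 _] := s2; split.
  by apply: measurable_funD => //; apply: measurable_funM => //; exact: measurable_cst.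
have [_ _] := L2rho_lc a (L2rho_weight s1) (L2rho_weight s2).
by under eq_integral do rewrite mulrA -mulrDl rho_sqrE.
Qed.

Lemma square_integrable_sum (I : Type) (s : seq I) (c : I -> R) (F : I -> T -> R) :
  (forall i, square_integrable (F i)) ->
  square_integrable (fun x => \sum_(i <- s) c i * F i x).
Proof.
move=> sF; elim: s => [|i s IH].
  under eq_fun do rewrite big_nil; apply: square_integrable_bounded.
  exact: bounded_mfun0.
by under eq_fun do rewrite big_cons; exact: square_integrable_lc.
Qed.

Section hilbert_schmidt_operator.
Variables (kappa : T -> T -> R) (B : R) (phi : nat -> T -> R).
Hypothesis feat : feature_expansion M kappa B phi.
Variables (A : (T -> R) -> charge T R) (G : nat -> T -> R) (N : T -> R).
Hypotheses (mG : forall k, measurable_fun M (G k))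
  (GN : forall x, M x -> (\sum_(k <oo) (G k x ^+ 2)%:E)%E = (N x)%:E)
  (Noo : (\int[leb]_(x in M) (rho0 x * N x)%:E < +oo)%E)
  (coefA : forall u, L2rho M rho0 u -> forall k,
     feature_coef M phi k (A u) = \int[leb]_(x in M) (u x * G k x)).

Let sum_int : (\sum_(k <oo) \int[leb]_(x in M) (G k x ^+ 2 * rho0 x)%:E =
  \int[leb]_(x in M) (rho0 x * N x)%:E)%E.
Proof.
rewrite -(@integral_nneseries _ _ _ leb M mM (fun k x => (G k x ^+ 2 * rho0 x)%:E)).
- apply: eq_integral => x /set_mem Mx; rewrite EFinM -GN// -nneseriesZl//.
    by apply: eq_eseriesr => k _; rewrite -EFinM mulrC.
  by move=> k _; rewrite lee_fin sqr_ge0.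
- by move=> k; apply/measurable_EFinP; apply: measurable_funM => //;
  exact: measurable_funX.
- by move=> k x Mx; rewrite lee_fin mulr_ge0 ?sqr_ge0 ?rho_ge0.
Qed.

Let int_ge0 k : (0 <= \int[leb]_(x in M) (G k x ^+ 2 * rho0 x)%:E)%E.
Proof.
by apply: integral_ge0 => x Mx; rewrite lee_fin mulr_ge0 ?sqr_ge0 ?rho_ge0.
Qed.

Let sG k : square_integrable (G k).
Proof.
split => //; apply: le_lt_trans Noo; rewrite -sum_int (@nneseriesD1 _ _ k)//.
  by rewrite leeDl// nneseries_ge0.
Qed.

Let coef_inner u k : L2rho M rho0 u ->
  feature_coef M phi k (A u) = inner_rho M rho0 (fun x => G k x * rho0 x) u.
Proof.
by move=> Lu; rewrite coefA// (si_sym semi_inner_L2rho) inner_rho_weight.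
Qed.

(** The square of the k-th coordinate of A e_j is the square of the inner product
    of e_j with G_k rho0.  All terms being nonnegative, the sum over the basis may
    be taken first, where Parseval applies. *)
Lemma hs_norm2E K e : orthonormal_basis M rho0 K e ->
  (hs_norm2 M kappa K e A = \int[leb]_(x in M) (rho0 x * N x)%:E)%E.
Proof.
move=> [Le ortho dense]; rewrite /hs_norm2 -sum_int.
(* Sums over K become series restricted by a predicate, which can be
   exchanged. *)
pose P i := `[< K i >].
have KE : K = [set i | P i] by apply/seteqP; split => i /= /asboolP.
pose a j k := ((if P j then inner_rho M rho0 (fun x =>
  G k x * rho0 x)%R (e j) else 0) ^+ 2)%R.
transitivity (\sum_(j <oo | P j) \sum_(k <oo) (a j k)%:E)%E.
  rewrite nneseries_esum; last by move=> j _; apply: nneseries_ge0 => k _ _;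
    rewrite lee_fin sqr_ge0.
  rewrite -KE; apply: eq_esum => j Kj; rewrite (norm2E_series mM feat).
  apply: eq_eseriesr => k _; rewrite coef_inner; last exact: Le.
  by rewrite /a /P asboolT.
rewrite nneseries_interchange; last by move=> j k; rewrite lee_fin sqr_ge0.
apply: eq_eseriesr => k _; rewrite -(inner_rho_sqr (sG k)).
have LG := L2rho_weight (sG k).
rewrite -(parseval semi_inner_L2rho Le ortho LG (dense _ LG)).
rewrite nneseries_esum; last by move=> j _; rewrite lee_fin sqr_ge0.
by rewrite -KE; apply: eq_esum => j Kj; rewrite /a /P asboolT.
Qed.

(** Cauchy-Schwarz in each coordinate, then summation over the coordinates. *)
Lemma norm2E_bound u : L2rho M rho0 u ->
  (norm2E M kappa (A u) <=
   (Rintegral leb M (fun x => rho0 x * N x) * inner_rho M rho0 u u)%:E)%E.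
Proof.
move=> Lu; rewrite (norm2E_series mM feat) EFinM /Rintegral fineK; last first.
  rewrite ge0_fin_numE//.
  apply: integral_ge0 => x Mx; rewrite lee_fin mulr_ge0 ?rho_ge0//.
  by rewrite -lee_fin -GN//; apply: nneseries_ge0 => k _ _; rewrite lee_fin sqr_ge0.
rewrite -sum_int muleC -nneseriesZl; last by move=> k _; exact: int_ge0.
apply: lee_nneseries; first by move=> k _ _; rewrite lee_fin sqr_ge0.
move=> k _; rewrite coef_inner// -(inner_rho_sqr (sG k)) -EFinM lee_fin mulrC.
by apply: (ip_CS semi_inner_L2rho) => //; exact: L2rho_weight.
Qed.

End hilbert_schmidt_operator.
End weighted_L2.

(** * Measures with a density *)

Section density_measure.
Context d (T : measurableType d) (R : realType).
Variables (mu : {sigma_finite_measure set T -> \bar R}) (w : T -> R).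
Hypotheses (w_ge0 : forall x, 0 <= w x) (iw : mu.-integrable setT (EFin \o w)).
Local Open Scope ereal_scope.

(** The proofs are arguments because the measure instance depends on them. *)
Definition density_measure of (forall x, (0 <= w x)%R) & mu.-integrable setT (EFin
  \o w) :=
  fun A : set T => \int[mu]_(x in A) (w x)%:E.

Local Notation nu := (density_measure w_ge0 iw).

Let nu0 : nu set0 = 0. Proof. exact: integral_set0. Qed.

Let nu_ge0 A : 0 <= nu A.
Proof. by apply: integral_ge0 => x _; rewrite lee_fin. Qed.

Let nu_sigma_additive : semi_sigma_additive nu.
Proof.
apply: (semi_sigma_additive_nng_induced (f := EFin \o w)); last first.
  by move=> x; rewrite lee_fin.
exact: (measurable_int mu).
Qed.

HB.instance Definition _ := isMeasure.Build _ _ _ nu nu0 nu_ge0 nu_sigma_additive.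

Let nu_fin : fin_num_fun nu.
Proof.
by move=> A mA; apply: integrable_fin_num => //; exact: integrableS iw.
Qed.

HB.instance Definition _ := Measure_isFinite.Build _ _ _ nu nu_fin.

Definition density : {finite_measure set T -> \bar R} := nu.

Lemma density_dominates : density `<< mu.
Proof.
apply/null_content_dominatesP => A mA muA.
apply: null_set_integral => //.
by apply: measurable_funTS; exact: (measurable_int mu).
Qed.

(** The Radon-Nikodym derivative of the measure with density w agrees with w almost
    everywhere, so the change of variables formula applies with w. *)
Lemma integral_density E (f : T -> \bar R) : (forall x, 0 <= f x) ->
  measurable E -> measurable_fun E f ->
  \int[density]_(x in E) f x = \int[mu]_(x in E) (f x * (w x)%:E).
Proof.
move=> f0 mE mf; have dom := density_dominates.
rewrite -(Radon_Nikodym_SigmaFinite.change_of_variables dom)//.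
have ifn := Radon_Nikodym_SigmaFinite.f_integrable dom.
have mw : measurable_fun setT (EFin \o w) by exact: (measurable_int mu).
apply: ae_eq_integral => //.
- apply: emeasurable_funM => //; apply: measurable_funTS; exact: (measurable_int mu).
- by apply: emeasurable_funM => //; exact: measurable_funTS.
have : ae_eq mu setT (Radon_Nikodym_SigmaFinite.f density mu) (EFin \o w).
  apply: integral_ae_eq => // A _ mA.
  by rewrite -(Radon_Nikodym_SigmaFinite.f_integral dom).
by apply: filterS => x h Ex; rewrite (h I).
Qed.

End density_measure.

(** * Existence of an orthonormal basis *)

Section orthonormal_basis.
Context {R : realType} {D : nat}.
Local Notation T := (D.-tuple R).
Local Notation leb := (lebesgue_tuple R D).
Variables (M : set T) (rho0 : T -> R) (kappa : T -> T -> R).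
Variables (B : R) (phi : nat -> T -> R).
Hypotheses (mM : measurable M) (dens : prob_density M rho0).
Hypotheses (feat : feature_expansion M kappa B phi)
  (univ : universal_kernel M kappa).

Let rho_ge0 x : M x -> 0 <= rho0 x. Proof. by move: x; have [] := dens. Qed.
Let mrho : measurable_fun M rho0. Proof. by have [] := dens. Qed.

Let w_ge0 x : 0 <= (rho0 \_ M) x.
Proof. by rewrite patchE; case: ifPn => // /set_mem; exact: rho_ge0. Qed.

Let iw : leb.-integrable setT (EFin \o (rho0 \_ M)).
Proof.
have := rho_integrable dens; rewrite integrable_mkcond//.
by apply: eq_integrable => // x _; rewrite /= !patchE; case: ifP.
Qed.

Definition rho_measure := density w_ge0 iw.

Lemma integral_rho_measure (g : T -> R) : measurable_fun M g ->
  (\int[rho_measure]_(y in M) (g y ^+ 2)%:E =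
   \int[leb]_(y in M) (g y ^+ 2 * rho0 y)%:E)%E.
Proof.
move=> mg; rewrite integral_density//.
- by apply: eq_integral => y yM; rewrite patchE yM.
- by move=> y; rewrite lee_fin sqr_ge0.
- by apply/measurable_EFinP; exact: measurable_funX.
Qed.

Let weighted k x := phi k x * rho0 x.

Let L2weighted k : L2rho M rho0 (weighted k).
Proof.
by apply: L2rho_weight => //; apply: square_integrable_bounded => //;
  exact: bounded_mfun_feature feat k.
Qed.

(** The feature expansion truncated at order m converges pointwise and boundedly to
    the combination of sections, hence in L2(rho0). *)
Lemma section_approx n (x : 'I_n -> T) (c : 'I_n -> R) : (forall i, M (x i)) ->
  let s y := \sum_(i < n) c i * kappa (x i) y in
  bounded_mfun M s /\ forall eps : R, 0 < eps -> exists m,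
  let sm y := \sum_(i < n) c i * (\sum_(k < m) phi k (x i) * phi k y) in
  \int[leb]_(y in M) ((s y - sm y) ^+ 2 * rho0 y) < eps.
Proof.
move=> Mx s; pose sm m y := \sum_(i < n) c i * (\sum_(k < m) phi k (x i) * phi k y).
pose C := \sum_(i < n) `|c i| * B.
have sm_cvg y : M y -> (fun m => sm m y) @ \oo --> s y.
  move=> My; apply: cvg_big => [|i _]; first exact: add_continuous.
  apply: cvgM; first exact: cvg_cst.
  exact: feature_cvg feat _ _ (Mx i) My.
have sm_bound m y : M y -> `|sm m y| <= C.
  move=> My; apply: le_trans (ler_norm_sum _ _ _) _; apply: ler_sum => i _.
  by rewrite normrM ler_wpM2l//; exact: (feature_partial_bound feat).
have bsm m : bounded_mfun M (sm m).
  by apply: bounded_mfun_sum => i; apply: bounded_mfun_sum => k;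
    exact: bounded_mfun_feature feat k.
have s_bound y : M y -> `|s y| <= C.
  move=> My; exact: (@norm_lim_le _ _ (s y) C (fun m => sm_bound m y My) (sm_cvg y My)).
have ms : measurable_fun M s.
  by apply: (@measurable_fun_cvg _ _ _ _ sm) => // m; have [] := bsm m.
split; first by split => //; exists C.
move=> eps eps0.
have [_ h] : leb.-integrable M (EFin \o fun=> 0 : R) /\
    \int[leb]_(y in M) ((s y - sm m y) ^+ 2 * rho0 y) @[m --> \oo]
      --> \int[leb]_(y in M) (0 : R).
  apply: (@Rdominated_convergence _ _ _ leb M mM _ _ (fun y => (C + C) ^+ 2 * rho0 y)).
  - move=> m; apply: measurable_funM => //; apply: measurable_funX.
    by apply: measurable_funB => //; have [] := bsm m.
  - move=> y My.
    have d0 : (fun m => s y - sm m y) @ \oo --> (0 : R).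
      rewrite -[X in _ --> X](subrr (s y)); apply: cvgB; first exact: cvg_cst.
      exact: sm_cvg.
    rewrite (_ : 0 = (0 : R) * 0 * rho0 y); last by rewrite !mul0r.
    by under eq_fun do rewrite expr2; apply: cvgM; [exact: (cvgM d0 d0)|exact: cvg_cst].
  - have := integrableZl mM ((C + C) ^+ 2) (rho_integrable dens).
    exact: eq_integrable.
  - move=> m y My; rewrite normrM (ger0_norm (rho_ge0 My)) ler_wpM2r ?rho_ge0//.
    rewrite normrX lerXn2r ?nnegrE//.
      by rewrite addr_ge0// (le_trans _ (s_bound _ My)).
    by apply: le_trans (ler_normB _ _) _; rewrite lerD ?s_bound ?sm_bound.
move: h; rewrite /Rintegral integral0 /= => /cvgrPdist_lt/(_ _ eps0)[m _ /(_ m)].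
rewrite /= leqnn => /(_ isT); rewrite sub0r normrN => h; exists m.
exact: le_lt_trans (ler_norm _) h.
Qed.

(** Divided by rho0, an element of L2(1/rho0) lies in L2(rho0), where universality
    approximates it by kernel sections and [section_approx] replaces these by
    features.  Gram-Schmidt then applies to the weighted features. *)
Lemma orthonormal_basis_exists : exists K e, orthonormal_basis M rho0 K e.
Proof.
have siP := semi_inner_L2rho mM dens.
have [|K onb] := @gram_schmidt_onb _ _ _ _ siP weighted L2weighted; last first.
  by exists K, (gram_schmidt (inner_rho M rho0) weighted).
move=> u Lu eps eps0; have [mu _ uoo] := Lu.
have mg : measurable_fun M (fun y => u y / rho0 y).
  by apply: measurable_funM => //; exact: measurable_rhoV.
have [_ /(_ rho_measure _ mg)] := univ.
(* These identities hold for r = 0 too, the inverse of 0 being 0. *)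
have quot_sqr (a r : R) : (a / r) ^+ 2 * r = a ^+ 2 / r.
  by have [->|r0] := eqVneq r 0; [rewrite invr0 !mulr0|field].
have quot_diff (a b r : R) : (a - b * r) * (a - b * r) / r = (a / r - b) ^+ 2 * r.
  by have [->|r0] := eqVneq r 0; [rewrite invr0 !mulr0|field].
rewrite integral_rho_measure//; under eq_integral do rewrite quot_sqr.
(* Two errors below eps / 4, doubled by the inequality |a + b|^2 <= 2|a|^2 +
   2|b|^2. *)
have e4 : 0 < eps / 4 by lra.
move=> /(_ uoo _ e4)[n [x [c [Mx]]]].
have [bs /(_ _ e4)[m hm]] := section_approx c Mx.
set s := fun y => \sum_(i < n) c i * kappa (x i) y in bs hm *.
set sm := fun y => \sum_(i < n) c i * (\sum_(k < m) phi k (x i) * phi k y) in hm.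
have ms : measurable_fun M s by have [] := bs.
have bsm : bounded_mfun M sm.
  by apply: bounded_mfun_sum => i; apply: bounded_mfun_sum => k;
    exact: bounded_mfun_feature feat k.
rewrite integral_rho_measure; last exact: measurable_funB.
have Ls := L2rho_weight dens (square_integrable_bounded mM dens bs).
have Lsm := L2rho_weight dens (square_integrable_bounded mM dens bsm).
have bd : bounded_mfun M (fun y => s y - sm y).
  rewrite (_ : (fun _ => _) = fun y => (-1) * sm y + s y); first exact: bounded_mfun_lc.
  by apply/funext => y; ring.
have sd := square_integrable_bounded mM dens bd.
have Ld := L2rho_weight dens sd.
move=> hu; exists (fun y => sm y * rho0 y).
  rewrite (_ : (fun y => sm y * rho0 y) =
    fun y => \sum_(i < n) c i * (\sum_(k < m) phi k (x i) * weighted k y)).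
    by apply: in_span_sum => i; apply: in_span_sum => k; exact: in_span_base.
  apply/funext => y; rewrite /sm mulr_suml; apply: eq_bigr => i _.
  by rewrite -mulrA mulr_suml; congr (_ * _); apply: eq_bigr => k _; rewrite mulrA.
have Lu' := si_sub siP Lu Ls.
rewrite (_ : (fun y => u y - sm y * rho0 y) =
  fun y => (u y - s y * rho0 y) + (s y - sm y) * rho0 y); last first.
  by apply/funext => y; ring.
apply: le_lt_trans (ipD_le siP Lu' Ld) _.
have h1 : inner_rho M rho0 (fun y => u y - s y * rho0 y) (fun y =>
  u y - s y * rho0 y) < eps / 4.
  rewrite -lte_fin (inner_rhoE mM dens Lu' Lu'); apply: le_lt_trans hu.
  rewrite le_eqVlt; apply/predU1P; left; apply: eq_integral => y _; congr EFin.
  exact: quot_diff.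
have h2 : inner_rho M rho0 (fun y => (s y - sm y) * rho0 y) (fun y =>
  (s y - sm y) * rho0 y) < eps / 4.
  apply: le_lt_trans hm; rewrite /inner_rho le_eqVlt; apply/predU1P; left.
  by apply: eq_Rintegral => y _; rewrite -expr2 rho_sqrE.
by lra.
Qed.

End orthonormal_basis.

(** * Mixtures of a Markov kernel *)

Section mixture.
Context d d' (X : measurableType d) (T : measurableType d') (R : realType).
Variables (mu : {measure set X -> \bar R}) (M : set X) (mM : measurable M).
Variables (p : R.-pker X ~> T) (u : X -> R).
Hypothesis iu : mu.-integrable M (EFin \o u).

Lemma pker_fin x A : measurable A -> p x A \is a fin_num.
Proof.
move=> mA; rewrite ge0_fin_numE//; apply: le_lt_trans (ltry 1).
rewrite -(@prob_kernel _ _ _ _ _ p x); apply: le_measure; rewrite ?inE//.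
Qed.

Lemma pker_le1 x A : measurable A -> fine (p x A) <= 1.
Proof.
move=> mA; rewrite -lee_fin fineK ?pker_fin// -(@prob_kernel _ _ _ _ _ p x).
by apply: le_measure; rewrite ?inE.
Qed.

Lemma measurable_pker A : measurable A -> measurable_fun setT (fun x => fine (p x A)).
Proof.
move=> mA; apply: (@measurable_comp _ _ _ _ _ _ setT (@fine R)) => //.
exact: measurable_kernel.
Qed.

Lemma integrable_mul_le1 (v h : X -> R) : mu.-integrable M (EFin \o v) ->
  measurable_fun M h ->
  (forall x, M x -> `|h x| <= 1) -> mu.-integrable M (EFin \o (fun x => v x * h x)).
Proof.
move=> iv mh h1; have mv : measurable_fun M v by apply/measurable_EFinP;
  have /integrableP[] := iv.
apply: (@le_Rintegrable _ _ _ mu M mM _ (fun x => `|v x|)).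
- exact: measurable_funM.
- by move=> x Mx; rewrite normrM ler_piMr// h1.
- exact: integrable_norm.
Qed.

Lemma mixture_integrable A : measurable A ->
  mu.-integrable M (EFin \o (fun x => u x * fine (p x A))).
Proof.
move=> mA; apply: integrable_mul_le1 => //.
  exact: measurable_funTS (measurable_pker mA).
by move=> x _; rewrite ger0_norm ?pker_le1// fine_ge0.
Qed.

(** The values of the kernel are taken as reals so that the integrand is
    real-valued; the proofs are arguments because they are needed to make it a
    signed measure. *)
Definition mixture of measurable M & mu.-integrable M (EFin \o u) :=
  fun A : set T => (\int[mu]_(x in M) (u x * fine (p x A))%:E)%E.

Local Notation nu := (mixture mM iu).

Let nu0 : nu set0 = 0%E.
Proof.
rewrite /mixture; under eq_integral do rewrite measure0 mulr0.
by rewrite integral0.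
Qed.

Let nu_fin : fin_num_fun nu.
Proof. by move=> A mA; apply: integrable_fin_num => //; exact: mixture_integrable. Qed.

Let nu_sigma_additive : semi_sigma_additive nu.
Proof.
move=> F mF tF mUF.
have mu_ : measurable_fun M u by apply/measurable_EFinP; have /integrableP[] := iu.
(* Countable additivity is dominated convergence with the bound |u|, the
   partial sums S n x being masses of sets and hence at most 1. *)
pose S n x := \sum_(0 <= i < n) fine (p x (F i)).
have SE n x : S n x = fine (p x (\big[setU/set0]_(i < n) F i)).
  rewrite measure_bigsetU// -sum_fine/=; first by rewrite /S big_mkord.
  by move=> i _; exact: pker_fin.
have mFn n : measurable (\big[setU/set0]_(i < n) F i) by exact: bigsetU_measurable.
have nuS n : (\sum_(0 <= i < n) nu (F i) = (\int[mu]_(x in M) (u x * S n x))%:E)%E.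
  rewrite /Rintegral fineK; last first.
    apply: integrable_fin_num => //; under eq_fun do rewrite SE.
    exact: mixture_integrable.
  rewrite -[LHS]integral_sum//=; last by move=> i; exact: mixture_integrable.
  by apply: eq_integral => x _; rewrite sumEFin mulr_sumr.
under eq_fun do rewrite nuS.
rewrite -[nu _]fineK; last exact: nu_fin.
apply: cvg_EFin; first exact: nearW.
have [||||_ //] := @Rdominated_convergence _ _ _ mu M mM (fun n x => u x * S n x)
  (fun x => u x * fine (p x (\bigcup_n F n))) (fun x => `|u x|).
- move=> n; apply: measurable_funM => //; rewrite (funext (SE n)).
  exact: measurable_funTS (measurable_pker (mFn n)).
- move=> x Mx; apply: cvgM; first exact: cvg_cst.
  suff h : (fun n => (S n x)%:E) @ \oo --> (fine (p x (\bigcup_n F n)))%:E.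
    exact: (fine_cvg h).
  rewrite fineK ?pker_fin//.
  have := @measure_semi_sigma_additive _ _ _ (p x) F mF tF mUF.
  rewrite (_ : (fun n => _) = fun n => (S n x)%:E)//.
  apply/funext => n; rewrite SE fineK ?pker_fin// measure_bigsetU//.
  by rewrite big_mkord.
- exact: integrable_norm.
- move=> n x Mx; rewrite normrM ler_piMr// SE.
  by rewrite ger0_norm ?pker_le1// fine_ge0.
Qed.

HB.instance Definition _ := isCharge.Build _ _ _ nu nu0 nu_fin nu_sigma_additive.

Definition mixture_charge : charge T R := nu.

Lemma mixture_chargeE A : measurable A ->
  mixture_charge A = (\int[mu]_(x in M) ((u x)%:E * p x A))%E.
Proof.
move=> mA; apply: eq_integral => x _.
by rewrite EFinM fineK// pker_fin.
Qed.

End mixture.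

(** * Transfer operators *)

Section transfer.
Context {R : realType} {D : nat}.
Local Notation T := (D.-tuple R).
Local Notation leb := (lebesgue_tuple R D).
Local Notation signed := (charge T R).
Variable M : set T.
Hypothesis mM : measurable M.
Implicit Types (g : T -> signed) (u v h : T -> R).

Lemma transferP g u : (exists nu, transfer_spec M g u nu) ->
  transfer_spec M g u (transfer M g u).
Proof. by move=> h; rewrite /transfer; case: pselect => // h';
  exact: projT2 (cid h'). Qed.

Lemma transfer_linear g a u v :
  (exists nu, transfer_spec M g u nu) -> (exists nu, transfer_spec M g v nu) ->
  (exists nu, transfer_spec M g (fun x => a * u x + v x) nu) ->
  forall B, measurable B -> (transfer M g (fun x => (a * u x + v x)%R) B =
    a%:E * transfer M g u B + transfer M g v B)%E.
Proof.
move=> /transferP su /transferP sv /transferP sw B mB.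
have [iu ->] := su B mB; have [iv ->] := sv B mB; have [iw ->] := sw B mB.
rewrite -integralZl// -integralD//; last exact: integrableZl.
apply: eq_integral => x _; rewrite muleA EFinD EFinM muleDl//.
by rewrite fin_num_measure.
Qed.

Lemma charge_int_ext (nu nu' : signed) h : (forall B, measurable B -> nu B = nu' B) ->
  bounded_mfun M h -> charge_int M nu h = charge_int M nu' h.
Proof.
move=> E; move: h; apply: (sigma_functional_ext mM);
  [exact: sigma_functional_charge_int..|].
by move=> A mA; rewrite !charge_int_indic// E//; exact: measurableI.
Qed.

Section clincomb.
Variables (m : nat) (f : 'I_m -> T -> R) (q : 'I_m -> signed).

(** Integrating out x in sum_i u(x) f_i(x) q_i leaves a finite combination of the
    measures q_i. *)
Lemma transfer_spec_clincomb u :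
  (forall i, leb.-integrable M (EFin \o (fun x => u x * f i x))) ->
  transfer_spec M (fun x => clincomb (f ^~ x) q) u
    (clincomb (fun i => \int[leb]_(x in M) (u x * f i x)) q).
Proof.
move=> iuf B mB.
have qB i : q i B = (fine (q i B))%:E by rewrite fineK// fin_num_measure.
have E x : ((u x)%:E * clincomb (f ^~ x) q B = 
    \sum_(i < m) (u x * f i x)%:E * (fine (q i B))%:E)%E.
  rewrite clincombE; under eq_bigr do rewrite qB -EFinM.
  rewrite sumEFin -EFinM mulr_sumr -sumEFin; apply: eq_bigr => i _.
  by rewrite -EFinM mulrA.
have ii i : leb.-integrable M (fun x => (u x * f i x)%:E * (fine (q i B))%:E)%E.
  exact: integrableZr (iuf i).
split.
  have := @integrable_sum _ _ _ leb M mM 'I_m (index_enum 'I_m) xpredT _ (fun i _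
    => ii i).
  by apply: eq_integrable => // x _; rewrite E.
rewrite clincombE; under [RHS]eq_integral do rewrite E.
rewrite integral_sum//; apply: eq_bigr => i _.
rewrite [RHS]integralZr//; last exact: iuf.
rewrite -qB /Rintegral fineK//.
exact: integrable_fin_num (iuf i).
Qed.

Lemma charge_int_transfer_clincomb u h :
  (forall i, leb.-integrable M (EFin \o (fun x => u x * f i x))) -> bounded_mfun M h ->
  charge_int M (transfer M (fun x => clincomb (f ^~ x) q) u) h =
  \int[leb]_(x in M) (u x * charge_int M (clincomb (f ^~ x) q) h).
Proof.
move=> iuf bh; have spec := transfer_spec_clincomb iuf.
have specT := transferP (ex_intro _ _ spec).
rewrite (@charge_int_ext _ (clincomb (fun i =>
  \int[leb]_(x in M) (u x * f i x)) q))//; last first.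
  by move=> B mB; rewrite (specT B mB).2 (spec B mB).2.
rewrite charge_int_clincomb//.
under [RHS]eq_Rintegral do rewrite charge_int_clincomb// mulr_sumr.
rewrite /Rintegral; under [in RHS]eq_integral do rewrite -sumEFin.
rewrite integral_sum//; last first.
  move=> i; have := integrableZr mM (charge_int M (q i) h) (iuf i).
  by apply: eq_integrable => // x _ /=; rewrite -EFinM mulrA.
rewrite -sum_fine/=; last first.
  move=> i _; apply: integrable_fin_num => //.
  have := integrableZr mM (charge_int M (q i) h) (iuf i).
  by apply: eq_integrable => // x _ /=; rewrite -EFinM mulrA.
apply: eq_bigr => i _; rewrite -[LHS](RintegralZr _ mM (iuf i)).
by apply: eq_Rintegral => x _; rewrite mulrA.
Qed.

End clincomb.

Section transition.
Variable p : R.-pker T ~> T.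

Lemma transfer_spec_transition u : leb.-integrable M (EFin \o u) ->
  exists nu, transfer_spec M (transition p) u nu.
Proof.
move=> iu; exists (mixture_charge mM p iu) => B mB; split; last first.
  exact: mixture_chargeE.
have := mixture_integrable mM p iu mB; apply: eq_integrable => // x _ /=.
by rewrite EFinM fineK// pker_fin.
Qed.

Lemma charge_int_transition x h : bounded_mfun M h ->
  charge_int M (transition p x) h = \int[p x]_(y in M) h y.
Proof.
move: h; apply: (sigma_functional_ext mM).
- exact: sigma_functional_charge_int.
- by apply: sigma_functional_int => //; rewrite ltey_eq pker_fin.
- by move=> A mA; rewrite charge_int_indic// Rintegral_indic.
Qed.

(** The measure p(x, .) gives M mass at most 1. *)
Lemma charge_int_transition_bound x h (b : R) : 0 <= b -> measurable_fun M h ->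
  (forall y, M y -> `|h y| <= b) -> `|charge_int M (transition p x) h| <= b.
Proof.
move=> b0 mh hb; have bh : bounded_mfun M h by split => //; exists b.
rewrite charge_int_transition//.
have pfin : (p x M < +oo)%E by rewrite ltey_eq pker_fin.
have ih := bounded_mfun_integrable mM pfin bh.
apply: le_trans (le_normr_Rintegral mM ih) _.
apply: (@le_trans _ _ (b * fine (p x M))); last first.
  by rewrite ler_piMr// pker_le1.
rewrite -(Rintegral_cst (p x) mM); apply: le_Rintegral => //.
  exact: integrable_norm.
apply: (@bounded_mfun_integrable _ _ _ _ mM (p x) (fun=> b)) => //.
by split; [exact: measurable_cst|exists `|b|].
Qed.

Lemma measurable_charge_int_transition h : bounded_mfun M h ->
  measurable_fun M (fun x => charge_int M (transition p x) h).
Proof.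
move: h; apply: (bounded_mfun_ind mM) => [A mA|a g h bg bh mg mh|g_ h b bg gb gh mg].
- under eq_fun do rewrite charge_int_indic//.
  exact: measurable_funTS (measurable_pker p (measurableI _ _ mA mM)).
- rewrite (_ : (fun x => _) = fun x =>
    a * charge_int M (transition p x) g + charge_int M (transition p x) h).
    by apply: measurable_funD => //; apply: measurable_funM => //; exact: measurable_cst.
  by apply/funext => x; rewrite (sigma_functional_charge_int mM _).1.
- apply: (@measurable_fun_cvg _ _ _ _ (fun n x =>
  charge_int M (transition p x) (g_ n))) => //.
  by move=> x Mx; exact: (sigma_functional_charge_int mM _).2 bg gb gh.
Qed.

(** Fubini for the kernel p and the signed density u.  Both sides are
    sigma-continuous functionals of h that agree on indicators, by the definition
    of the transfer operator. *)
Lemma charge_int_transfer_transition u h : leb.-integrable M (EFin \o u) ->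
  bounded_mfun M h ->
  charge_int M (transfer M (transition p) u) h =
  \int[leb]_(x in M) (u x * charge_int M (transition p x) h).
Proof.
move=> iu.
have mu : measurable_fun M u by apply/measurable_EFinP; have /integrableP[] := iu.
have ius h' : bounded_mfun M h' ->
    leb.-integrable M (EFin \o (fun x => u x * charge_int M (transition p x) h')).
  move=> bh; have [mh [b hb]] := bh.
  apply: (@le_Rintegrable _ _ _ leb M mM _ (fun x => `|b| * `|u x|)).
  - by apply: measurable_funM => //; exact: measurable_charge_int_transition.
  - move=> x Mx; rewrite normrM mulrC ler_wpM2r//;
    apply: charge_int_transition_bound => //.
    by move=> y My; apply: le_trans (hb y My) (ler_norm _).
  - by have := integrableZl mM `|b| (integrable_norm iu); exact: eq_integrable.
have spec := transferP (transfer_spec_transition iu).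
move: h; apply: (sigma_functional_ext mM).
- exact: sigma_functional_charge_int.
- split=> [a g h bg bh|g_ h b bg gb gh].
    rewrite -(RintegralZl _ mM (ius g bg)) -RintegralD//; last 2 first.
    + by have := integrableZl mM a (ius g bg); exact: eq_integrable.
    + exact: ius.
    apply: eq_Rintegral => x _; rewrite (sigma_functional_charge_int mM _).1//.
    by ring.
  have [||||_ //] := @Rdominated_convergence _ _ _ leb M mM
     (fun n x => u x * charge_int M (transition p x) (g_ n))
     (fun x => u x * charge_int M (transition p x) h) (fun x => `|b| * `|u x|).
  + by move=> n; apply: measurable_funM => //; exact: measurable_charge_int_transition.
  + move=> x Mx; apply: cvgM; first exact: cvg_cst.
    exact: (sigma_functional_charge_int mM _).2 bg gb gh.
  + by have := integrableZl mM `|b| (integrable_norm iu); exact: eq_integrable.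
  + move=> n x Mx; rewrite normrM mulrC ler_wpM2r//;
    apply: charge_int_transition_bound => //.
      by have [] := bg n.
    by move=> y My; apply: le_trans (gb n y My) (ler_norm _).
- move=> A mA; have mAM := measurableI _ _ mA mM.
  rewrite charge_int_indic// (spec _ mAM).2; congr fine; apply: eq_integral => x _.
  by rewrite charge_int_indic// EFinM fineK// fin_num_measure.
Qed.

End transition.
End transfer.

(** * The modeling error *)

Section modeling_error.
Context {R : realType} {D : nat}.
Local Notation T := (D.-tuple R).
Local Notation leb := (lebesgue_tuple R D).
Local Notation signed := (charge T R).
Variables (M : set T) (rho0 : T -> R) (p : R.-pker T ~> T) (kappa : T -> T -> R).
Variables (m : nat) (f : 'I_m -> T -> R) (q : 'I_m -> signed).
Variables (B : R) (phi : nat -> T -> R).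
Hypotheses (mM : measurable M) (dens : prob_density M rho0)
  (pM : forall x, M x -> p x M = 1%E)
  (feat : feature_expansion M kappa B phi) (B_ge0 : 0 <= B)
  (univ : universal_kernel M kappa)
  (mf : forall i, measurable_fun M (f i))
  (foo : forall i, (Epairs M rho0 p (fun x _ => (f i x ^+ 2)%R) < +oo)%E).

Let ptau := transition p.
Let phat x := clincomb (f ^~ x) q.
Let err x := csub (phat x) (ptau x).
Let P := transfer M ptau.
Let Phat := transfer M phat.
Let error u := csub (Phat u) (P u).
Local Notation "<< nu , nu' >>" := (inner M kappa nu nu').
Local Notation cf := (feature_coef M phi).

Let rho_ge0 x : M x -> 0 <= rho0 x. Proof. by move: x; have [] := dens. Qed.
Let mrho : measurable_fun M rho0. Proof. by have [] := dens. Qed.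

(** Because p(x, .) gives M mass 1 for x in M. *)
Lemma Epairs_fst (h : T -> R) :
  Epairs M rho0 p (fun x _ => h x) = (\int[leb]_(x in M) (h x * rho0 x)%:E)%E.
Proof.
apply: eq_integral => x /set_mem Mx.
by rewrite integral_cst// pM// mule1 -EFinM mulrC.
Qed.

Lemma square_integrable_f i : square_integrable M rho0 (f i).
Proof. by split => //; rewrite -Epairs_fst. Qed.

Let sf := square_integrable_f.

Lemma L2rho_integrable u : L2rho M rho0 u -> leb.-integrable M (EFin \o u).
Proof.
move=> Lu; have s1 : square_integrable M rho0 (fun=> 1).
  apply: square_integrable_bounded => //; split; first exact: measurable_cst.
  by exists 1 => x _; rewrite normr1.
have := L2rho_pair_integrable mM dens Lu s1; apply: eq_integrable => // x _ /=.
by rewrite mulr1.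
Qed.

Lemma operator_of_transition : operator_of_density M rho0 ptau.
Proof.
by move=> u Lu; apply: transferP; apply: transfer_spec_transition => //;
  exact: L2rho_integrable.
Qed.

Let iuf u i : L2rho M rho0 u -> leb.-integrable M (EFin \o (fun x => u x * f i x)).
Proof. by move=> Lu; exact: (L2rho_pair_integrable mM dens Lu (sf i)). Qed.

Lemma operator_of_clincomb : operator_of_density M rho0 phat.
Proof.
move=> u Lu; apply: transferP; eexists; apply: (transfer_spec_clincomb mM q) => i.
exact: iuf.
Qed.

Let bphi k : bounded_mfun M (phi k) := bounded_mfun_feature feat k.

Let bounded_mfun_cf_transition h : bounded_mfun M h -> bounded_mfun M (fun x =>
  charge_int M (ptau x) h).
Proof.
move=> bh; have [mh [b hb]] := bh; split; first exact: measurable_charge_int_transition.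
exists `|b| => x Mx; apply: charge_int_transition_bound => //.
by move=> y My; apply: le_trans (hb y My) (ler_norm _).
Qed.

Lemma coef_transfer u k : L2rho M rho0 u ->
  cf k (P u) = \int[leb]_(x in M) (u x * cf k (ptau x)).
Proof. by move=> Lu; apply: charge_int_transfer_transition => //;
  exact: L2rho_integrable. Qed.

Let s_cf_phat k : square_integrable M rho0 (fun x => cf k (phat x)).
Proof.
rewrite (_ : (fun x => _) = fun x => \sum_(i < m) cf k (q i) * f i x).
  by apply: (square_integrable_sum mM dens _ _ sf).
by apply/funext => x; rewrite /feature_coef charge_int_clincomb//;
  apply: eq_bigr => i _; rewrite mulrC.
Qed.

Let s_cf_ptau k : square_integrable M rho0 (fun x => cf k (ptau x)).
Proof. by apply: square_integrable_bounded => //; exact: bounded_mfun_cf_transition. Qed.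

Lemma coef_error u k : L2rho M rho0 u ->
  cf k (error u) = \int[leb]_(x in M) (u x * cf k (err x)).
Proof.
move=> Lu; rewrite /feature_coef charge_int_csub// -/(cf k (P u)) coef_transfer//.
rewrite [X in X - _](charge_int_transfer_clincomb mM)//; last by move=> i; exact: iuf.
rewrite -RintegralB//.
- by apply: eq_Rintegral => x _; rewrite -mulrBr charge_int_csub.
- exact: (L2rho_pair_integrable mM dens Lu (s_cf_phat k)).
- exact: (L2rho_pair_integrable mM dens Lu (s_cf_ptau k)).
Qed.

Lemma measurable_coef_err k : measurable_fun M (fun x => cf k (err x)).
Proof.
rewrite (_ : (fun x => _) = fun x => cf k (phat x) - cf k (ptau x)).
  by apply: measurable_funB; [have [] := s_cf_phat k|have [] := s_cf_ptau k].
by apply/funext => x; rewrite /feature_coef charge_int_csub.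
Qed.

(** On M, the measure p(x, .) has mass at most 1 and kappa is bounded by B. *)
Lemma norm_transition_bound x : `|<<ptau x, ptau x>>| <= B.
Proof.
apply: charge_int_transition_bound => //; first by have [] :=
  bounded_mfun_embedded mM feat (ptau x).
move=> y My; apply: charge_int_transition_bound => //; first by have [] :=
  bounded_mfun_section feat My.
by move=> z Mz; exact: (kernel_bound feat).
Qed.

Lemma measurable_norm_transition : measurable_fun M (fun x => <<ptau x, ptau x>>).
Proof.
apply: (@measurable_fun_cvg _ _ _ _
  (fun n x => \sum_(k < n) cf k (ptau x) * cf k (ptau x))).
  move=> n; apply: measurable_sum => k.
  by apply: measurable_funM; have [] := s_cf_ptau k.
move=> x _. exact: (inner_cvg mM feat (nu := ptau x) (nu' := ptau x)).
Qed.

Let series_norm (g : T -> signed) x :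
  (\sum_(k <oo) (cf k (g x) ^+ 2)%:E)%E = (<<g x, g x>>)%:E.
Proof. by rewrite -(norm2E_series mM feat) -(innerEE mM feat). Qed.

Lemma integrable_norm_transition :
  leb.-integrable M (EFin \o (fun x => rho0 x * <<ptau x, ptau x>>)).
Proof.
apply: (@le_Rintegrable _ _ _ leb M mM _ (fun x => B * rho0 x)).
- by apply: measurable_funM => //; exact: measurable_norm_transition.
- move=> x Mx; rewrite normrM ger0_norm ?rho_ge0// mulrC ler_wpM2r ?rho_ge0//.
  exact: norm_transition_bound.
- by have := integrableZl mM B (rho_integrable dens); exact: eq_integrable.
Qed.

Lemma norm_errE x : <<err x, err x>> =
  \sum_(i < m) \sum_(j < m) <<q j, q i>> * (f i x * f j x)
  + \sum_(i < m) (- 2) * (f i x * <<q i, ptau x>>) + <<ptau x, ptau x>>.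
Proof.
have symE := inner_sym mM feat.
have csubE := inner_csubr mM feat.
have combE nu c : <<nu, clincomb c q>> = _ := inner_clincombr mM feat nu c q.
rewrite csubE ![<<err x, _>>]symE !csubE (symE (ptau x) (phat x)).
rewrite -mulr_sumr !combE.
have -> : <<phat x, ptau x>> = \sum_(i < m) f i x * <<q i, ptau x>>.
  by rewrite symE combE; apply: eq_bigr => i _; rewrite symE.
have -> : \sum_(i < m) f i x * <<phat x, q i>> =
    \sum_(i < m) \sum_(j < m) <<q j, q i>> * (f i x * f j x).
  apply: eq_bigr => i _; rewrite symE combE mulr_sumr; apply: eq_bigr => j _.
  by rewrite (symE (q i)); ring.
by ring.
Qed.

Lemma CffE i j : Cff M rho0 p f i j = \int[leb]_(x in M) (f i x * f j x * rho0 x).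
Proof. by rewrite mxE Epairs_fst. Qed.

Lemma CqqE i j : Cqq M kappa q i j = <<q i, q j>>.
Proof. by rewrite mxE (innerEE mM feat). Qed.

(** By symmetry of the inner product, the entry is the integral of the embedding
    of q_j against the transfer of f_i rho0, to which
    [charge_int_transfer_transition] applies. *)
Lemma CfqE i j : Cfq M rho0 kappa p f q i j =
  \int[leb]_(x in M) (f i x * <<q j, ptau x>> * rho0 x).
Proof.
rewrite mxE (innerEE mM feat)/= (inner_sym mM feat) /inner.
rewrite charge_int_transfer_transition//.
- by apply: eq_Rintegral => x _; rewrite /inner; ring.
- exact: L2rho_integrable (L2rho_weight dens (sf i)).
- exact: (bounded_mfun_embedded mM feat (q j)).
Qed.

(** Term by term integration of [norm_errE]: the q-q terms give the trace of
    C_ff C_qq, the cross terms twice the trace of C_fq. *)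
Lemma integral_norm_err :
  leb.-integrable M (EFin \o (fun x => rho0 x * <<err x, err x>>)) /\
  \int[leb]_(x in M) (rho0 x * <<err x, err x>>) =
  - score M rho0 kappa p f q + \int[leb]_(x in M) (rho0 x * <<ptau x, ptau x>>).
Proof.
pose F i j x := <<q j, q i>> * (f i x * f j x * rho0 x).
pose H i x := (- 2) * (f i x * <<q i, ptau x>> * rho0 x).
have iff i j : leb.-integrable M (EFin \o (fun x => f i x * f j x * rho0 x)).
  exact: (square_integrable_mul mM dens (sf i) (sf j)).
have ifh i : leb.-integrable M (EFin \o (fun x => f i x * <<q i, ptau x>> * rho0 x)).
  apply: (square_integrable_mul mM dens (sf i)).
  apply: square_integrable_bounded => //; apply: bounded_mfun_cf_transition;
    exact: (bounded_mfun_embedded mM feat (q i)).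
have iF i j : leb.-integrable M (EFin \o F i j).
  by have := integrableZl mM <<q j, q i>> (iff i j); exact: eq_integrable.
have iH i : leb.-integrable M (EFin \o H i).
  by have := integrableZl mM (- 2) (ifh i); exact: eq_integrable.
have sF i := Rintegral_sum mM (index_enum 'I_m) (iF i).
have [iSF SFE] := Rintegral_sum mM (index_enum 'I_m) (fun i => (sF i).1).
have [iSH SHE] := Rintegral_sum mM (index_enum 'I_m) iH.
have iSFH : leb.-integrable M (EFin \o (fun x =>
    \sum_(i < m) \sum_(j < m) F i j x + \sum_(i < m) H i x)).
  by have := integrableD mM iSF iSH; exact: eq_integrable.
have E x : rho0 x * <<err x, err x>> =
    \sum_(i < m) \sum_(j < m) F i j x + \sum_(i < m) H i x
    + rho0 x * <<ptau x, ptau x>>.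
  rewrite norm_errE !mulrDr !mulr_sumr; congr (_ + _ + _).
    apply: eq_bigr => i _; rewrite mulr_sumr; apply: eq_bigr => j _.
    by rewrite /F; ring.
  by apply: eq_bigr => i _; rewrite /H; ring.
have iN := integrable_norm_transition.
split.
  by under eq_fun do rewrite E; have := integrableD mM iSFH iN; exact: eq_integrable.
under eq_Rintegral do rewrite E.
rewrite RintegralD// RintegralD// SFE SHE; congr (_ + _).
rewrite /score /mxtrace -sumrN -big_split/=; apply: eq_bigr => i _.
rewrite (sF i).2 !mxE -/(Cfq M rho0 kappa p f q i i) opprB addrC.
have -> : \sum_(j < m) Cff M rho0 p f i j * Cqq M kappa q j i =
    \sum_(j < m) \int[leb]_(x in M) F i j x.
  apply: eq_bigr => j _; rewrite CffE CqqE /F (RintegralZl _ mM (iff i j)).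
  by rewrite mulrC.
rewrite addrC; congr (_ + _); rewrite /H (RintegralZl _ mM (ifh i)) mulNr;
  congr (- (_ * _)).
by rewrite -CfqE mxE.
Qed.

Let lty_of_integrable (h : T -> R) : leb.-integrable M (EFin \o h) ->
  (\int[leb]_(x in M) (h x)%:E < +oo)%E.
Proof. by move=> /(integrable_fin_num mM); rewrite fin_numE => /andP[_];
  rewrite ltey. Qed.

Lemma hs_norm2_transition K e : orthonormal_basis M rho0 K e ->
  (hs_norm2 M kappa K e P = \int[leb]_(x in M) (rho0 x * <<ptau x, ptau x>>)%:E)%E.
Proof.
move=> onb; apply: (hs_norm2E mM dens feat _ _ _ _ onb (G := fun k x => cf k (ptau x))).
- by move=> k; have [] := s_cf_ptau k.
- by move=> x _; exact: series_norm.
- exact: lty_of_integrable integrable_norm_transition.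
- by move=> u Lu k; exact: coef_transfer.
Qed.

Lemma hs_norm2_error K e : orthonormal_basis M rho0 K e ->
  (hs_norm2 M kappa K e error = \int[leb]_(x in M) (rho0 x * <<err x, err x>>)%:E)%E.
Proof.
move=> onb; apply: (hs_norm2E mM dens feat _ _ _ _ onb (G := fun k x => cf k (err x))).
- exact: measurable_coef_err.
- by move=> x _; exact: series_norm.
- exact: lty_of_integrable integral_norm_err.1.
- by move=> u Lu k; exact: coef_error.
Qed.

Let L2E_all nu : L2E M kappa nu.
Proof. by rewrite /L2E /norm2E (innerEE mM feat). Qed.

Let transfer_lin g : operator_of_density M rho0 g ->
  forall a u v, L2rho M rho0 u -> L2rho M rho0 v -> forall A, measurable A ->
  (transfer M g (fun x => (a * u x + v x)%R) A =
   a%:E * transfer M g u A + transfer M g v A)%E.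
Proof.
move=> opg a u v Lu Lv A mA; apply: transfer_linear => //.
- by exists (transfer M g u); exact: opg.
- by exists (transfer M g v); exact: opg.
- by eexists; apply: opg; exact: L2rho_lc.
Qed.

Lemma hilbert_schmidt_transition : hilbert_schmidt M rho0 kappa P.
Proof.
split; first split.
- by move=> u _; exact: L2E_all.
- exact: transfer_lin operator_of_transition.
- exists (\int[leb]_(x in M) (rho0 x * <<ptau x, ptau x>>)) => u Lu.
  apply: (norm2E_bound mM dens feat _ _ _ _ Lu (G := fun k x => cf k (ptau x))).
  + by move=> k; have [] := s_cf_ptau k.
  + by move=> x _; exact: series_norm.
  + exact: lty_of_integrable integrable_norm_transition.
  + by move=> v Lv k; exact: coef_transfer.
have [K [e onb]] := orthonormal_basis_exists mM dens feat univ.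
exists K, e; split => //; rewrite hs_norm2_transition//.
exact: lty_of_integrable integrable_norm_transition.
Qed.

Lemma hilbert_schmidt_error : hilbert_schmidt M rho0 kappa error.
Proof.
split; first split.
- by move=> u _; exact: L2E_all.
- move=> a u v Lu Lv A mA.
  have csubE nu1 nu2 : csub nu1 nu2 A = (fine (nu1 A) - fine (nu2 A))%:E.
    by rewrite EFinB !fineK ?fin_num_measure.
  rewrite !csubE /Phat /P !transfer_lin//; [|exact: operator_of_transition
    |exact: operator_of_clincomb].
  rewrite !fineD ?fineM ?fin_numM ?fin_num_measure// -EFinM -EFinD; congr EFin.
  by rewrite /=; ring.
- exists (\int[leb]_(x in M) (rho0 x * <<err x, err x>>)) => u Lu.
  apply: (norm2E_bound mM dens feat _ _ _ _ Lu (G := fun k x => cf k (err x))).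
  + exact: measurable_coef_err.
  + by move=> x _; exact: series_norm.
  + exact: lty_of_integrable integral_norm_err.1.
  + by move=> v Lv k; exact: coef_error.
have [K [e onb]] := orthonormal_basis_exists mM dens feat univ.
exists K, e; split => //; rewrite hs_norm2_error//.
exact: lty_of_integrable integral_norm_err.1.
Qed.

End modeling_error.

Theorem proposition3 (R : realType) (D : nat) (M : set (D.-tuple R))
    (rho0 : D.-tuple R -> R) (p : R.-pker (D.-tuple R) ~> (D.-tuple R))
    (kappa : D.-tuple R -> D.-tuple R -> R)
    (m : nat) (f : 'I_m -> D.-tuple R -> R)
    (q : 'I_m -> {charge set (D.-tuple R) -> \bar R}) :
  measurable M ->
  prob_density M rho0 ->
  (forall x, M x -> p x M = 1%E) ->
  psd_kernel M kappa ->
  universal_kernel M kappa ->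
  bounded_kernel M kappa ->
  (forall i, measurable_fun M (f i)) ->
  (forall i, (Epairs M rho0 p (fun x _ => (f i x ^+ 2)%R) < +oo)%E) ->
  (forall i, (q i).-null_set (~` M)) ->
  let ptau := transition p in
  let phat := fun x => clincomb (f ^~ x) q in
  let P := transfer M ptau in
  let Phat := transfer M phat in
  let error := fun u => csub (Phat u) (P u) in
  [/\ operator_of_density M rho0 ptau /\ operator_of_density M rho0 phat,
      hilbert_schmidt M rho0 kappa P,
      hilbert_schmidt M rho0 kappa error,
      (forall K e, orthonormal_basis M rho0 K e ->
         hs_norm2 M kappa K e error =
         (\int[lebesgue_tuple R D]_(x in M)
            ((rho0 x)%:E * norm2E M kappa (csub (phat x) (ptau x))))%E)
    & (forall K e, orthonormal_basis M rho0 K e ->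
         hs_norm2 M kappa K e error =
         ((- score M rho0 kappa p f q)%:E + hs_norm2 M kappa K e P)%E)].
Proof.
move=> mM dens pM psd univ bnd mf foo _ ptau phat P Phat error.
have M0 : M !=set0.
  apply/set0P; apply: contraPN dens => /eqP -> [_ _].
  by rewrite integral_set0 => /eqP; rewrite eq_sym onee_eq0.
have [B [phi feat]] := feature_expansion_exists mM M0 psd univ.1 bnd.
have B_ge0 : 0 <= B.
  by have [x Mx] := M0; have := feature_bound feat 0 Mx; rewrite big_ord0.
have [iE intE] := integral_norm_err q mM dens pM feat B_ge0 mf foo.
have iP := integrable_norm_transition p mM dens feat B_ge0.
split.
- split; first exact: operator_of_transition.
  exact: (operator_of_clincomb q mM dens pM mf foo).
- exact: (hilbert_schmidt_transition p mM dens feat B_ge0 univ).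
- exact: (hilbert_schmidt_error q mM dens pM feat B_ge0 univ mf foo).
- move=> K e onb; rewrite (hs_norm2_error q mM dens pM feat B_ge0 mf foo onb).
  by apply: eq_integral => x _; rewrite /norm2E (innerEE mM feat) EFinM.
- move=> K e onb; rewrite (hs_norm2_error q mM dens pM feat B_ge0 mf foo onb).
  rewrite (hs_norm2_transition p mM dens feat B_ge0 onb).
  rewrite -(fineK (integrable_fin_num mM iE)) -(fineK (integrable_fin_num mM iP)).
  by rewrite -EFinD; congr EFin; exact: intE.
Qed.
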